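(* Let $G$ be a finite group and let $\chi$ be a complex irreducible character of $G$ that is orthogonal and of even degree $n := \chi(1) \in 2\mathbb{Z}$. Let $K = \mathbb{Q}(\chi(g) \mid g \in G)$ be the character field of $\chi$. Then there is a unique totally positive square class $\det(\chi) = d\,(K^{\times})^2 \in K^{\times}/(K^{\times})^2$ with the following property: for every field $L \supseteq K$ and every representation $\rho : G \to \mathrm{GL}_n(L)$ with character $\chi$, every nonzero $B \in \mathcal{F}(\rho)$ satisfies $\det(B) \in \det(\chi)\,(L^{\times})^2$ (that is, $\det(B) \in d\,(L^{\times})^2$).
   Context: For a field $L$, an $L$-representation of degree $n$ of a finite group $G$ is a group homomorphism $\rho : G \to \mathrm{GL}_n(L)$; its character is $\chi_\rho = \mathrm{trace} \circ \rho$. For such $\rho$ put $$\mathcal{F}(\rho) := \{ B \in L^{n \times n} \mid B = B^{tr} \text{ and } \rho(g) B \rho(g)^{tr} = B \text{ for all } g \in G \},$$ the $L$-vector space of $G$-invariant symmetric bilinear forms on the row space $L^n$ (given by their Gram matrices). A representation $\rho$ and also its character are called orthogonal if $\mathcal{F}(\rho)$ contains a non-degenerate element (one with nonzero determinant). A complex irreducible character is orthogonal if and only if it is the character of a real representation $G \to \mathrm{GL}_n(\mathbb{R})$. A square class $d(K^\times)^2$ in a number field $K$ is totally positive if $d$ is positive under every embedding $K \hookrightarrow \mathbb{R}$; here all embeddings of the character field $K$ into $\mathbb{C}$ are real. *)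

(* Defs.v *)
From HB Require Import structures.
From mathcomp Require Import all_boot all_order all_algebra.
From mathcomp Require Import all_fingroup all_solvable all_field all_character.
From mathcomp Require Import reals.

Set Implicit Arguments.
Unset Strict Implicit.
Unset Printing Implicit Defensive.

Import Order.TTheory GRing.Theory Num.Theory.
Local Open Scope ring_scope.

(* B is an element of the space F(rho) of G-invariant symmetric bilinear
   forms.  Matrices act on row vectors, as everywhere in MathComp. *)
Definition invariant_form (gT : finGroupType) (G : {group gT}) (L : fieldType)
    (n : nat) (rho : mx_representation L G n) (B : 'M[L]_n) : Prop :=
  B^T = B /\ (forall g : gT, g \in G -> rho g *m B *m (rho g)^T = B).

Definition orthogonal_repr (gT : finGroupType) (G : {group gT})
    (L : fieldType) (n : nat) (rho : mx_representation L G n) : Prop :=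
  exists2 B : 'M[L]_n, invariant_form rho B & \det B != 0.

(* Complex characters are those of MathComp, with values in algC. *)
Definition orthogonal_char (gT : finGroupType) (G : {group gT})
    (chi : 'CF(G)) : Prop :=
  exists n : nat, exists2 rho : mx_representation algC G n,
    cfRepr rho = chi & orthogonal_repr rho.

(* The number field K, embedded in algC by sigma, is Q(chi(g) | g in G): the
   preimages in K of the values of chi generate K over Q. *)
Definition is_character_field (gT : finGroupType) (G : {group gT})
    (chi : 'CF(G)) (K : fieldExtType rat) (sigma : {rmorphism K -> algC}) :
    Prop :=
  exists2 s : seq K, [seq sigma x | x <- s] = [seq chi g | g in G]
                   & <<1 & s>>%VS = fullv.

Lemma character_field_exists (gT : finGroupType) (G : {group gT})
    (chi : 'CF(G)) :
  exists (K : fieldExtType rat) (sigma : {rmorphism K -> algC}),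
    is_character_field chi sigma.
Proof.
have [K [sigma [s Ds genK]]] := num_field_exists [seq chi g | g in G].
by exists K, sigma, s.
Qed.

(* rho, defined over an extension iota : K -> L of the subfield sigma : K ->
   algC, has character chi: the values of chi lie in K, and the trace of rho
   is their image in L. *)
Definition has_character (gT : finGroupType) (G : {group gT}) (chi : 'CF(G))
    (K : fieldType) (sigma : {rmorphism K -> algC})
    (L : fieldType) (iota : {rmorphism K -> L})
    (n : nat) (rho : mx_representation L G n) : Prop :=
  forall g : gT, g \in G ->
    exists2 x : K, sigma x = chi g & \tr (rho g) = iota x.

(* Any two instances of realType are isomorphic, so R ranges over the copies
   of the field of real numbers. *)
Definition totally_positive (K : fieldType) (d : K) : Prop :=
  forall (R : realType) (tau : {rmorphism K -> R}), 0 < tau d.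

(* a is d times the square of a nonzero element of L. *)
Definition in_square_class (L : fieldType) (d a : L) : Prop :=
  exists2 c : L, c != 0 & a = d * c ^+ 2.

(* The square class of d contains the determinant of every nonzero invariant
   form of every representation with character chi over an extension of K. *)
Definition is_orthogonal_det (gT : finGroupType) (G : {group gT})
    (chi : 'CF(G)) (n : nat) (K : fieldType) (sigma : {rmorphism K -> algC})
    (d : K) : Prop :=
  forall (L : fieldType) (iota : {rmorphism K -> L})
         (rho : mx_representation L G n),
    has_character chi sigma iota rho ->
    forall B : 'M[L]_n, invariant_form rho B -> B != 0 ->
      in_square_class (iota d) (\det B).

(* Main.v *)
Require Import Defs.
From HB Require Import structures.
From mathcomp Require Import all_boot all_order all_algebra.
From mathcomp Require Import all_fingroup all_solvable all_field all_character.
From mathcomp Require Import boolp reals polyrcf.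

Set Implicit Arguments.
Unset Strict Implicit.
Unset Printing Implicit Defensive.

Import Order.TTheory GRing.Theory Num.Theory.
Local Open Scope ring_scope.

(* Existence.  Choose integers h(g) with h(g^-1) = - h(g) such that
   X = sum_g h(g) g is invertible in the given representation, and let d be
   its determinant.  By Newton's identities d is a polynomial in the values of
   chi, so it lies in K and is the same for all representations with character
   chi.  For an invariant form B the matrix rho(X) B is skew-symmetric, so
   that d det B is a square.  Moreover X acts on the regular representation by
   a skew-symmetric rational matrix, so under a real embedding of K its
   characteristic polynomial has no real root and its constant term d is
   positive.

   Uniqueness.  No Schur index or local-global argument is used: there is a
   field L containing K over which chi is realized, and in which no nonsquare
   of K becomes a square.  Take T = sum_g f_g(t) g with f_g in K[t] chosen so
   that, at some algebraic t = theta, det(x - T) is an Eisenstein polynomial in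
   x with respect to u = t - theta.  It is then irreducible over the field of
   rational functions in u over the algebraic numbers, and L = K(t)(z) for a
   root z.  The adjugate of z - T has rank one, and produces a representation
   over L. *)

(** * Newton's identities for matrices *)

Lemma deriv_prod (R : comNzRingType) (I : eqType) (s : seq I)
    (F : I -> {poly R}) : uniq s ->
  (\prod_(i <- s) F i)^`() =
    \sum_(i <- s) (F i)^`() * \prod_(j <- s | j != i) F j.
Proof.
elim: s => [|a s IHs] /=; first by rewrite !big_nil derivC.
case/andP=> s'a /IHs{}IHs; rewrite !big_cons derivM IHs eqxx /=;
  congr (_ * _ + _).
  rewrite -[RHS]big_filter -[s in LHS](_ : [seq j <- s | j != a] = s) //.
  by apply/all_filterP/allP=> j sj; apply: contraNneq s'a => <-.
rewrite mulr_sumr; apply: eq_big_seq => i si.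
rewrite big_cons ifT; last by apply: contraNneq s'a => ->.
by rewrite mulrCA.
Qed.

(** Differentiate the Leibniz expansion row by row: only diagonal entries of xI - A have a nonzero
    derivative, namely 1, so differentiating row k leaves the k-th principal cofactor. *)
Lemma mxtrace_adj_char_poly_mx (R : comNzRingType) n (A : 'M[R]_n) :
  \tr (\adj (char_poly_mx A)) = (char_poly A)^`().
Proof.
pose M := char_poly_mx A.
(* [N k] is xI - A with row k replaced by its derivative, the k-th unit vector. *)
pose N k := \matrix_(i, j) if i == k then (j == k)%:R else M i j.
have detN k : \det (N k) = cofactor M k k.
  rewrite (expand_det_row _ k) (bigD1 k) //= big1 => [|j jk]; last first.
    by rewrite mxE eqxx (negPf jk) mul0r.
  rewrite addr0 mxE !eqxx mul1r; congr (_ * \det _).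
  by apply/matrixP=> i j; rewrite !mxE eq_sym (negPf (neq_lift _ _)).
have dM i j : (M i j)^`() = (i == j)%:R.
  by rewrite !mxE derivB derivMn derivX derivC subr0.
rewrite /char_poly /determinant linear_sum /mxtrace /=.
under eq_bigr => k _ do rewrite mxE -detN.
rewrite exchange_big /=; apply: eq_bigr => s _.
have -> (p : {poly R}) : ((-1) ^+ s * p)^`() = (-1) ^+ s * p^`().
  by case: (odd_perm s); rewrite ?expr1 ?mulN1r ?mul1r ?derivN.
rewrite -mulr_sumr; congr (_ * _); rewrite deriv_prod ?index_enum_uniq //.
apply: eq_bigr => k _; rewrite (bigD1 k) //= mxE eqxx dM eq_sym; congr (_ * _).
by apply: eq_bigr => i ik; rewrite mxE (negPf ik).
Qed.

Lemma Cayley_Hamilton_sum (R : comNzRingType) n (A : 'M[R]_n.+1) :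
  \sum_(j < n.+2) (char_poly A)`_j *: A ^+ j = 0.
Proof.
set p := char_poly A; rewrite -[RHS](Cayley_Hamilton A) -/p.
have -> : horner_mx A p = horner_mx A (\sum_(j < n.+2) p`_j *: 'X^j).
  by rewrite -poly_def -(size_char_poly A) coefK.
rewrite linear_sum; apply: eq_bigr => j _.
by rewrite /= linearZ /= rmorphXn /= horner_mx_X.
Qed.

(** Since p(A) = 0, p(x)I is the sum of the p_j (x^j - A^j), and each x^j - A^j factors through xI -
    A. The cofactor found this way agrees with the adjugate after multiplication by the monic p,
    which cancels. *)
Lemma adj_char_poly_mx (R : idomainType) n (A : 'M[R]_n.+1) :
  \adj (char_poly_mx A) = \sum_(j < n.+2) \sum_(i < j)
    ((char_poly A)`_j)%:P *: ('X ^+ (j.-1 - i) *: map_mx polyC (A ^+ i)).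
Proof.
set S := \sum_(j < n.+2) _; set p := char_poly A.
have pE : p = \sum_(j < n.+2) p`_j *: 'X^j.
  by rewrite -[LHS]coefK poly_def size_char_poly.
have scX e : ('X ^+ e)%:M = 'X%:M ^+ e :> 'M[{poly R}]_n.+1.
  by elim: e => // e IHe; rewrite !exprS scalar_mxM IHe.
have mapX e : map_mx polyC (A ^+ e) = (map_mx polyC A) ^+ e.
  by elim: e => [|e IHe]; rewrite ?map_mx1 // !exprS map_mxM IHe.
have MS : char_poly_mx A *m S = p%:M.
  have CH : \sum_(j < n.+2) p`_j *: A ^+ j = 0 by exact: Cayley_Hamilton_sum.
  have -> : p%:M = \sum_(j < n.+2)
      (p`_j)%:P *: (('X%:M) ^+ j - (map_mx polyC A) ^+ j) :> 'M_n.+1.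
    under eq_bigr => j _ do rewrite scalerBr.
    rewrite sumrB [X in _ - X](_ : _ = map_mx polyC (\sum_(j < n.+2) p`_j *: A
      ^+ j)).
      rewrite CH map_mx0 subr0 [in LHS]pE raddf_sum /=; apply: eq_bigr => j _.
      by rewrite -scX -mul_polyC scalar_mxM mul_scalar_mx.
    rewrite map_mx_sum; apply: eq_bigr => j _.
    by rewrite map_mxZ mapX.
  rewrite /S mulmx_sumr; apply: eq_bigr => j _.
  rewrite subrXX_comm; last exact: comm_scalar_mx.
  rewrite /char_poly_mx -scaler_sumr -scalemxAr; congr (_ *: (_ *m _)).
  apply: eq_bigr => i _.
  by rewrite -mul_scalar_mx scX mapX.
have : p *: S = p *: \adj (char_poly_mx A).
  by rewrite -!mul_scalar_mx -{1}mul_adj_mx -mulmxA MS scalar_mxC.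
move/matrixP=> eqS; apply/matrixP=> i j; move: (eqS i j); rewrite !mxE.
by move/(mulfI (monic_neq0 (char_poly_monic A))) => ->.
Qed.

(** Compare coefficients of x^(n-m) in tr(adj(xI - A)) = p'(x). The top case m = n+1 is the trace of
    the Cayley-Hamilton equation instead. *)
Lemma newton_identity (R : idomainType) n (A : 'M[R]_n.+1) m : (m <= n.+1)%N ->
  m%:R * (char_poly A)`_(n.+1 - m) =
    - \sum_(i < m) (char_poly A)`_(n.+1 - i) * \tr (A ^+ (m - i)).
Proof.
set p := char_poly A => le_m_n.
(* The added term i = m is (n+1) p_(n+1-m), because tr(A^0) = n+1. *)
suffices H : \sum_(i < m.+1) p`_(n.+1 - i) * \tr (A ^+ (m - i)) =
    (n.+1 - m)%:R * p`_(n.+1 - m).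
  move: H; rewrite big_ord_recr /= subnn expr0 mxtrace1 natrB // mulrBl.
  move/(canRL (addrK _)) => ->; rewrite [_ * n.+1%:R]mulrC.
  by rewrite addrC addKr opprK.
move: le_m_n; rewrite leq_eqVlt => /predU1P[->|lt_m_n].
  rewrite subnn mul0r (reindex_inj rev_ord_inj) /=.
  have := congr1 mxtrace (Cayley_Hamilton_sum A).
  rewrite -/p mxtrace0 linear_sum; apply: etrans; apply: eq_bigr => j _.
  by rewrite subSS /= linearZ /= subKn // -ltnS.
have := congr1 (fun q : {poly R} => q`_(n - m)) (mxtrace_adj_char_poly_mx A).
rewrite coef_deriv -/p mulr_natl -subSn // => <-.
rewrite adj_char_poly_mx linear_sum coef_sum -/p; clearbody p.
rewrite [RHS](reindex_inj rev_ord_inj) /=.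
rewrite (big_ord_widen n.+2 (fun i =>
  p`_(n.+1 - i) * \tr (A ^+ (m - i)))) ?ltnS; last exact: ltnW.
rewrite big_mkcond /=; apply: eq_bigr => i _;
  rewrite subSS linear_sum coef_sum /=.
have trE c e (B : 'M[R]_n.+1) k :
    (\tr (c%:P *: ('X ^+ e *: map_mx polyC B)))`_k = c * (\tr B * (k == e)%:R).
  by rewrite !mxtraceZ trace_map_mx coefCM coefMC coefXn [X in _ * X]mulrC.
rewrite (eq_bigr _ (fun j _ => trE _ _ _ _)) -mulr_sumr.
(* For fixed i, the coefficient of x^(n-m) receives only the power A^(m-i), and nothing at all when
   i >= m. *)
have eqE (j : 'I_(n.+1 - i)) :
    ((n - m)%N == ((n.+1 - i).-1 - j)%N) = ((i + j)%N == m).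
  have := ltn_ord j; rewrite ltn_subRL ltnS => le_ij.
  by rewrite predn_sub -subnDA eqn_sub2lE // eq_sym.
case: ltnP => im.
  have lt_mi : (m - i < n.+1 - i)%N by rewrite ltn_sub2r // (leq_trans im).
  rewrite (bigD1 (Ordinal lt_mi)) //= big1 => [|j].
    by rewrite (eqE (Ordinal lt_mi)) /= subnKC // eqxx mulr1 addr0.
  rewrite -val_eqE /= => ji; rewrite eqE.
  by rewrite -[X in _ == X](@subnKC i m) ?eqn_add2l ?(negPf ji) ?mulr0 ?im.
rewrite big1 ?mulr0 // => j _; rewrite eqE gtn_eqF ?mulr0 //.
exact: leq_trans im (leq_addr _ _).
Qed.

(** Newton's identities are solved recursively for the coefficients, dividing by positive integers.
    The solution depends only on the traces [t i], so one [p] over [D] serves for all [E], [phi] and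
    [A]. *)
Lemma char_poly_of_traces (D : comUnitRingType) n (t : nat -> D) :
    (forall k, k.+1%:R \is a @GRing.unit D) ->
  exists2 p : {poly D}, p \is monic /\ size p = n.+2 &
    forall (E : idomainType) (phi : {rmorphism D -> E}) (A : 'M[E]_n.+1),
      (forall i, \tr (A ^+ i) = phi (t i)) -> char_poly A = map_poly phi p.
Proof.
move=> natU.
have [e e0 De]: exists2 e : nat -> D, e 0 = 1 &
    forall (E : idomainType) (phi : {rmorphism D -> E}) (A : 'M[E]_n.+1),
      (forall i, \tr (A ^+ i) = phi (t i)) ->
    forall i, (i <= n.+1)%N -> (char_poly A)`_(n.+1 - i) = phi (e i).
  suffices: forall m, exists2 e : nat -> D, e 0 = 1 &
      forall (E : idomainType) (phi : {rmorphism D -> E}) (A : 'M[E]_n.+1),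
        (forall i, \tr (A ^+ i) = phi (t i)) ->
      forall i, (i <= m)%N -> (i <= n.+1)%N ->
        (char_poly A)`_(n.+1 - i) = phi (e i).
    by case/(_ n.+1)=> e e0 De; exists e => // E phi A DA i le_i; apply: De.
  elim=> [|m [e e0 De]].
    exists (fun=> 1) => // E phi A _ i; rewrite leqn0 => /eqP-> _.
    have /monicP := char_poly_monic A.
    by rewrite lead_coefE size_char_poly subn0 rmorph1.
  pose em := - (m.+1%:R)^-1 * \sum_(i < m.+1) e i * t (m.+1 - i)%N.
  exists (fun i => if i == m.+1 then em else e i) => // E phi A DA i.
  rewrite leq_eqVlt; case: eqP => [-> _ /= le_m | _ /=]; last exact: De.
  apply: (@mulrI _ m.+1%:R).
    by rewrite -(rmorph_nat phi) rmorph_unit.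
  rewrite newton_identity // -(rmorph_nat phi) -rmorphM /em mulrA mulrN divrr
    //.
  rewrite mulN1r rmorphN rmorph_sum; congr (- _); apply: eq_bigr => j _.
  have := ltn_ord j; rewrite rmorphM /= DA ltnS => le_j.
  by rewrite (De _ phi A) // (leq_trans le_j) // ltnW.
exists (\poly_(i < n.+2) e (n.+1 - i)%N) => [|E phi A DA].
  have lc : e (n.+1 - n.+1)%N != 0 by rewrite subnn e0 oner_eq0.
  by rewrite monicE lead_coef_poly // subnn e0 eqxx size_poly_eq.
apply/polyP=> i; rewrite coef_map coef_poly; case: ltnP => [lt_i|le_i].
  by have := De E phi A DA _ (leq_subr i n.+1); rewrite subKn.
by rewrite nth_default ?size_char_poly // raddf0.
Qed.

(** * Determinants *)

(** The square root is the Pfaffian, computed by elimination: split off an invertible skew 2 by 2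
    block, whose determinant is a square, and recurse on its Schur complement, which is again
    skew. *)
Lemma det_skew_square (F : fieldType) n (A : 'M[F]_n) :
  2%:R != 0 :> F -> A^T = - A -> exists c, \det A = c ^+ 2.
Proof.
move=> nz2; have dbl0 (x : F) : x = - x -> x = 0.
  move/eqP; rewrite -subr_eq0 opprK -mulr2n -mulr_natl mulf_eq0 (negPf nz2).
  by move/eqP.
have [m] := ubnP n; elim: m n A => // m IHm [|[|n]] A le_nm skA.
- by exists 1; rewrite det_mx00 expr1n.
- exists 0; rewrite det_mx11 expr0n; apply: dbl0.
  by move/matrixP/(_ 0 0): skA; rewrite !mxE.
have A00 i : A i i = 0 by apply: dbl0; move/matrixP/(_ i i): skA; rewrite !mxE.
have [/existsP[j nz0j] | ] := boolP [exists j, A 0 j != 0]; last first.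
  rewrite negb_exists => /forallP A0; exists 0.
  rewrite (expand_det_row _ 0) expr0n big1 // => j _.
  by have /negPn/eqP-> := A0 j; rewrite mul0r.
(* Conjugation by this transposition moves the nonzero entry of row 0 to position (0, 1); [lift 0 0]
   is the index 1. *)
pose P := tperm_mx j (lift 0 0) : 'M[F]_n.+2.
have detP : \det P ^+ 2 = 1 by rewrite det_perm sqrr_sign.
pose B : 'M_(2 + n) := P *m A *m P^T.
have detB : \det A = \det B by rewrite !det_mulmx det_tr mulrAC -expr2 detP
  mul1r.
have skB : B^T = - B by rewrite !trmx_mul trmxK skA mulNmx mulmxN mulmxA.
have B01 : B 0 (lift 0 0) != 0.
  rewrite /B /P /tperm_mx tr_perm_mx -row_permE -col_permE !mxE tpermR tpermD
    //.
  by apply: contraNneq nz0j => ->; rewrite A00.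
clearbody B; pose a := B 0 (lift 0 0); pose J := ulsubmx B; pose b := ursubmx B.
have skBE i k : B i k = - B k i by move/matrixP/(_ k i): skB; rewrite !mxE.
have eqB (i i' k k' : 'I_(2 + n)) : i = i' :> nat -> k = k' :> nat ->
  B i k = B i' k'.
  by move=> /ord_inj-> /ord_inj->.
have J00 : J 0 0 = 0 by apply: dbl0; rewrite {1}mxE {1}mxE skBE !mxE.
have J11 : J 1 1 = 0 by apply: dbl0; rewrite {1}mxE {1}mxE skBE !mxE.
have J01 : J 0 1 = a by rewrite !mxE; apply: eqB.
have J10 : J 1 0 = - a by rewrite -J01 !mxE skBE.
have detJ : \det J = a ^+ 2.
  rewrite (expand_det_row _ 0) big_ord_recl big_ord1.
  rewrite (_ : lift 0 0 = 1 :> 'I_2); last exact/ord_inj.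
  rewrite J00 J01 mul0r add0r /cofactor det_mx11 !mxE.
  have BE : B (lshift n 1) (lshift n 0) = - a by rewrite -J10 !mxE.
  rewrite (_ : B _ _ = - a) ; last first.
    by rewrite -BE; apply: eqB.
  by rewrite /= expr1 mulN1r opprK.
have uJ : J \in unitmx by rewrite unitmxE detJ unitfE expf_neq0.
have skJ : J^T = - J by rewrite /J trmx_ulsub skB; apply/matrixP=> i k;
  rewrite !mxE.
have skb : dlsubmx B = - b^T.
  by rewrite trmx_ursub skB; apply/matrixP=> i k; rewrite !mxE opprK.
have skD : (drsubmx B)^T = - drsubmx B.
  by rewrite trmx_drsub skB; apply/matrixP=> i k; rewrite !mxE.
(* The Schur complement of [J]; the plus sign comes from the lower left block being - b^T. *)
pose S := drsubmx B + b^T *m invmx J *m b.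
have [||c detS] := IHm _ S.
- exact: ltnW.
- have invN : invmx (- J) = - invmx J.
    by rewrite -!scaleN1r invmxZ ?invrN1 // unitmxZ ?unitrN1 ?uJ.
  by rewrite /S linearD /= !trmx_mul trmxK trmx_inv skJ skD invN opprD mulNmx
    mulmxN mulmxA.
exists (a * c); rewrite exprMn -detJ -detS detB -[B]submxK skb -/J -/b.
have -> : block_mx J b (- b^T) (drsubmx B) =
    block_mx 1%:M 0 (- b^T *m invmx J) 1%:M *m block_mx J b 0 S.
  rewrite mulmx_block !mul1mx !mul0mx !addr0 mulmxKV //.
  by rewrite /S addrCA !mulNmx addNr addr0.
by rewrite det_mulmx det_lblock det_ublock !det1 !mul1r.
Qed.

Lemma skew_unit_exists (F : fieldType) n : ~~ odd n ->
  exists2 J : 'M[F]_n, J^T = - J & J \in unitmx.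
Proof.
move=> /even_halfK <-; rewrite -addnn; set m := n./2.
exists (block_mx 0 1%:M (- 1%:M) 0).
  by rewrite tr_block_mx !trmx0 linearN /= trmx1 opp_block_mx oppr0 opprK.
suffices /mulmx1_unit[] : block_mx 0 1%:M (- 1%:M) 0 *m
  block_mx 0 (- 1%:M) 1%:M 0 = 1%:M :> 'M[F]_(m + m) by [].
rewrite mulmx_block !mul0mx !mulmx0 !mul1mx add0r !addr0 mulNmx mulmxN mul1mx
  opprK.
by rewrite [RHS]scalar_mx_block.
Qed.

Lemma horner_det_pencil (R : comNzRingType) n (A B : 'M[R]_n) x :
  (\det (map_mx polyC A + 'X *: map_mx polyC B)).[x] = \det (A + x *: B).
Proof.
rewrite -horner_evalE -det_map_mx; congr (\det _).
by apply/matrixP=> k l; rewrite !mxE /= horner_evalE !hornerE.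
Qed.

(* The coordinates become natural numbers one at a time. *)
Lemma det_comb_nat_neq0 (F : numFieldType) n (I : eqType) (s : seq I)
    (Z : I -> 'M[F]_n) (y : I -> F) (M : 'M[F]_n) : uniq s ->
  \det (M + \sum_(i <- s) y i *: Z i) != 0 ->
  exists a : I -> nat, \det (M + \sum_(i <- s) (a i)%:R *: Z i) != 0.
Proof.
elim: s M => [|i s IHs] M /=; 
  first by move=> _; rewrite big_nil => nz_M; exists (fun=> 0%N);
    rewrite big_nil.
case/andP=> s'i uniq_s; rewrite big_cons addrA => /(IHs _ uniq_s)[a nz_a].
pose N := M + \sum_(j <- s) (a j)%:R *: Z j.
pose p := \det (map_mx polyC N + 'X *: map_mx polyC (Z i)).
have pE x : p.[x] = \det (N + x *: Z i) by exact: horner_det_pencil.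
have nz_p : p != 0.
  by apply: contraNneq nz_a => p0; rewrite addrAC -/N -pE p0 horner0.
have [k nz_k] : exists k : nat, p.[k%:R] != 0.
  (* These are [size p] distinct naturals, one more than the degree of [p], so not all are roots. *)
  pose rs : seq F := [seq k%:R | k <- iota 0 (size p)].
  have [/(max_poly_roots nz_p)|] := boolP (all (root p) rs).
    rewrite map_inj_uniq ?iota_uniq => [/(_ isT)|k l /eqP].
      by rewrite size_map size_iota ltnn.
    by rewrite eqr_nat => /eqP.
  by case/allPn=> x /mapP[k _ ->] nz_k; exists k.
exists (fun j => if j == i then k else a j).
rewrite big_cons eqxx addrA addrAC.
rewrite (eq_big_seq (fun j => (a j)%:R *: Z j)) => [|j sj];
  first by rewrite -pE.
by rewrite ifN //; apply: contraNneq s'i => <-.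
Qed.

(** A nonzero cofactor gives M rank at least n-1, and the rows of adj M lie in the left kernel of M,
    which is therefore at most a line. *)
Lemma adj_rank1 (F : fieldType) n (M : 'M[F]_n) :
    \det M = 0 -> \adj M != 0 ->
  exists (u : 'cV[F]_n) (v : 'rV[F]_n), \adj M = u *m v.
Proof.
move=> det0 nz_adj.
have [i [j nz_ij]] : exists i j, cofactor M i j != 0.
  have [/existsP[i /existsP[j nz_ij]]|] := boolP [exists i, exists j, cofactor
    M i j != 0].
    by exists i, j.
  rewrite negb_exists => /forallP no; case/eqP: nz_adj; apply/matrixP=> i j.
  have := no j; rewrite negb_exists => /forallP/(_ i)/negPn/eqP.
  by rewrite !mxE.
have rkM : (n.-1 <= \rank M)%N.
  have : \rank (row' i (col' j M)) = n.-1.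
    apply/mxrank_unit; rewrite unitmxE unitfE; apply: contraNneq nz_ij.
    by rewrite /cofactor => ->; rewrite mulr0.
  move=> <-; rewrite row'Esub (leq_trans (mxrankS (rowsub_sub _ _))) //.
  by rewrite -mxrank_tr tr_col' row'Esub -[leqRHS]mxrank_tr mxrankS //
    rowsub_sub.
have rk1 : (\rank (\adj M) <= 1)%N.
  have /mxrankS : (\adj M <= kermx M)%MS by apply/sub_kermxP;
    rewrite mul_adj_mx det0 raddf0.
  rewrite mxrank_ker => /leq_trans-> //; rewrite leq_subLR addn1.
  exact: leq_trans (leqSpred n) _.
have {rk1}rk1 : \rank (\adj M) = 1%N.
  by apply/eqP; rewrite eqn_leq rk1 lt0n mxrank_eq0.
rewrite -[\adj M]mulmx_base; move: (col_base _) (row_base _); rewrite rk1.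
by move=> u v; exists u, v.
Qed.

(** * Invariant forms *)

Lemma mxtrace_mxvec (R : comNzRingType) n (A B : 'M[R]_n) :
  \tr (A *m B) = (mxvec A *m (mxvec B^T)^T) 0 0.
Proof.
rewrite mxE (reindex _ (curry_mxvec_bij _ _)) /=.
transitivity (\sum_i \sum_j A i j * B j i).
  by apply: eq_bigr => i _; rewrite mxE.
rewrite pair_bigA; apply: eq_bigr => -[i j] _ /=.
by rewrite [in RHS]mxE !mxvecE mxE.
Qed.

(* The rank of the trace form on the group algebra is visible in K, and it is
   [n ^ 2] exactly when the representation is absolutely irreducible. *)
Lemma abs_irr_same_character (gT : finGroupType) (G : {group gT}) n
    (K E F : fieldType) (sigma : {rmorphism K -> E}) (iota : {rmorphism K -> F})
    (rE : mx_representation E G n) (rF : mx_representation F G n) (chi : gT ->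
      K) :
    {in G, forall g, \tr (rE g) = sigma (chi g)} ->
    {in G, forall g, \tr (rF g) = iota (chi g)} ->
  mx_absolutely_irreducible rE -> mx_absolutely_irreducible rF.
Proof.
move=> DE DF irrE; have /mx_abs_irrP[n_gt0 [a Da]] := irrE.
rewrite /mx_absolutely_irreducible n_gt0 /=.
(* The trace of XY pairs the vector of X with that of the transpose of Y, so the Gram matrix of the
   trace form factors through the enveloping algebra matrix. *)
pose D (L : fieldType) (r : mx_representation L G n) :=
  \matrix_(i < #|G|) mxvec (r (enum_val i))^T.
pose Gram := \matrix_(i < #|G|, j < #|G|) chi (enum_val i * enum_val j)%g.
have GramE (L : fieldType) (r : mx_representation L G n) (f : {rmorphism K ->
  L}) :
    {in G, forall g, \tr (r g) = f (chi g)} ->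
  map_mx f Gram = enveloping_algebra_mx r *m (D L r)^T.
  move=> Dr; apply/matrixP=> i j; rewrite !mxE -Dr ?groupM ?enum_valP //.
  rewrite repr_mxM ?enum_valP // mxtrace_mxvec mxE; apply: eq_bigr => k _.
  by rewrite !mxE.
have fullD : row_full (D E rE).
  rewrite -sub1mx; apply/row_subP=> i.
  rewrite -[row i _]vec_mxK -[vec_mx _]trmxK (Da (vec_mx _)^T).
  rewrite !linear_sum summx_sub // => x Gx; rewrite !linearZ scalemx_sub //.
  by rewrite (eq_row_sub (enum_rank_in Gx x)) // rowK enum_rankK_in.
have fullE : row_full (enveloping_algebra_mx rE) by case/andP: irrE.
have rkGram : \rank Gram = (n * n)%N.
  rewrite -(mxrank_map sigma) (GramE _ rE) // (eqmxMfull _ fullE) mxrank_tr.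
  exact/eqP.
rewrite /row_full eqn_leq rank_leq_col -[X in (X <= _)%N]rkGram.
by rewrite -(mxrank_map iota) (GramE _ rF) // mxrankM_maxl.
Qed.

Lemma invariant_form_mull (gT : finGroupType) (G : {group gT}) (F : fieldType)
    n (rho : mx_representation F G n) (B : 'M[F]_n) g :
  invariant_form rho B -> g \in G -> rho g *m B = B *m (rho g^-1%g)^T.
Proof.
case=> _ invB Gg; rewrite -{2}(invB g Gg) -!mulmxA -trmx_mul.
by rewrite -repr_mxM ?groupV // mulVg repr_mx1 trmx1 mulmx1.
Qed.

(** The kernel of an invariant form is a submodule, so by irreducibility it is zero unless B = 0. *)
Lemma invariant_form_nondegenerate (gT : finGroupType) (G : {group gT})
    (F : fieldType) n (rho : mx_representation F G n) (B : 'M[F]_n) :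
    mx_irreducible rho -> invariant_form rho B -> B != 0 -> \det B != 0.
Proof.
move=> /mx_irrP[_ irr] invB nz_B.
rewrite -unitfE -unitmxE -row_free_unit -kermx_eq0.
apply: contraR nz_B => /irr full_ker.
rewrite -submx0 -[B]mul1mx; have : (1%:M <= kermx B)%MS.
  rewrite sub1mx full_ker //; apply/mxmoduleP=> g Gg; apply/sub_kermxP.
  by rewrite -mulmxA (invariant_form_mull invB) // mulmxA mulmx_ker mul0mx.
by move/sub_kermxP=> ->.
Qed.

(** Transposition turns rho(g) B into rho(g^-1) B, so an odd combination times B is
    skew-symmetric. *)
Lemma det_odd_comb_square (gT : finGroupType) (G : {group gT}) (F : fieldType)
    n (rho : mx_representation F G n) (B : 'M[F]_n) (h : gT -> F) :
    2%:R != 0 :> F -> invariant_form rho B ->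
      {in G, forall g, h g^-1%g = - h g} ->
  exists c, \det (\sum_(g in G) h g *: rho g) * \det B = c ^+ 2.
Proof.
move=> nz2 invB odd_h; rewrite -det_mulmx; apply: det_skew_square => //.
rewrite trmx_mul (proj1 invB) linear_sum mulmx_sumr mulmx_suml -sumrN /=.
rewrite (reindex_inj invg_inj) /=; apply: eq_big => [g|g];
  rewrite groupV // => Gg.
rewrite odd_h // linearZ /= scaleNr linearN /= -scalemxAr -scalemxAl.
by rewrite (invariant_form_mull invB).
Qed.

(** With J skew and invertible, J B^-1 is an invertible odd combination up to the factor 2.
    Nonvanishing of the determinant then survives a change to natural coefficients, and
    antisymmetrizing these gives integers. *)
Lemma odd_comb_det_neq0 (gT : finGroupType) (G : {group gT}) (F : numFieldType)
    n (rho : mx_representation F G n) (B : 'M[F]_n) :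
    mx_absolutely_irreducible rho -> invariant_form rho B -> B != 0 ->
      ~~ odd n ->
  exists2 h : gT -> int, {in G, forall g, h g^-1%g = - h g} &
    \det (\sum_(g in G) (h g)%:~R *: rho g) != 0.
Proof.
move=> irr invB nz_B even_n.
have uB : B \in unitmx.
  by rewrite unitmxE unitfE (invariant_form_nondegenerate (mx_abs_irrW irr)
    invB).
have [J skJ uJ] := skew_unit_exists F even_n.
have /mx_abs_irrP[_ [a Da]] := irr; pose y g := a g (J *m invmx B).
pose Z g := rho g - rho g^-1%g.
have DJ : \sum_(g in G) y g *: (rho g *m B) = J.
  rewrite -[RHS](mulmxKV uB) [J *m _]Da mulmx_suml.
  by apply: eq_bigr => g _; rewrite scalemxAl.
(* This is the transpose of the expansion [DJ]; subtracting the two antisymmetrizes the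
   coefficients. *)
have DJV : \sum_(g in G) y g *: (rho g^-1%g *m B) = - J.
  rewrite -skJ -DJ linear_sum; apply: eq_bigr => g Gg.
  rewrite linearZ /= trmx_mul (proj1 invB) (invariant_form_mull invB) ?groupV
    //.
  by rewrite invgK.
have DY : \sum_(g in G) y g *: Z g = 2%:R *: (J *m invmx B).
  apply: (can_inj (mulmxK uB)); rewrite -scalemxAl mulmxKV // scaler_nat mulr2n.
  rewrite -[X in _ + X]opprK -DJV -[X in X - _]DJ -sumrB mulmx_suml.
  by apply: eq_bigr => g _; rewrite -scalemxAl mulmxBl scalerBr.
have nz_Y : \det (0 + \sum_(g <- enum G) y g *: Z g) != 0.
  rewrite add0r big_enum DY detZ mulf_neq0 //.
    by rewrite expf_neq0 // pnatr_eq0.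
  by rewrite -unitfE -unitmxE unitmx_mul uJ unitmx_inv.
have [b] := det_comb_nat_neq0 (enum_uniq _) nz_Y.
rewrite add0r big_enum /= => nz_b.
exists (fun g => (b g)%:Z - (b g^-1%g)%:Z) => [g _|];
  first by rewrite invgK opprB.
rewrite [X in \det X](_ : _ = \sum_(g in G) (b g)%:R *: Z g) //.
under eq_bigr => g _ do rewrite intrB scalerBl.
under [RHS]eq_bigr => g _ do rewrite scalerBr.
rewrite !sumrB; congr (_ - _); rewrite (reindex_inj invg_inj) /=.
by apply: eq_big => [g|g _]; rewrite ?groupV // invgK.
Qed.

(** Powers are computed in the group algebra by convolution, so the coefficients [b] are common to
    all representations and all base changes [phi]. *)
Lemma group_comb_exp (gT : finGroupType) (G : {group gT}) (D : comNzRingType)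
    (f : gT -> D) i :
  exists b : gT -> D, forall (E : comUnitRingType) (phi : {rmorphism D -> E}) n
      (rho : mx_representation E G n.+1),
    (\sum_(g in G) phi (f g) *: rho g) ^+ i = \sum_(g in G) phi (b g) *: rho g.
Proof.
elim: i => [|i [b Db]].
  exists (fun g => (g == 1%g)%:R) => E phi n rho; rewrite expr0.
  rewrite (bigD1 1%g) //= eqxx rmorph1 scale1r repr_mx1 big1 ?addr0 // => g.
  by case/andP=> _ /negPf->; rewrite rmorph0 scale0r.
exists (fun k => \sum_(g in G) f g * b (g^-1 * k)%g) => E phi n rho.
rewrite exprS Db mulr_suml.
under [RHS]eq_bigr => k _ do rewrite rmorph_sum scaler_suml.
rewrite [RHS]exchange_big /=; apply: eq_bigr => g Gg.
rewrite mulr_sumr [RHS](reindex_inj (mulgI g)) /=.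
apply: eq_big => [k|k Gk]; first by rewrite groupMl.
rewrite mulKg rmorphM repr_mxM // -scalerA.
by rewrite -[LHS]scalemxAl -scalemxAr.
Qed.

(** The traces of all powers of the combination are determined by [f] and [chi], and they determine
    the characteristic polynomial. *)
Lemma char_poly_group_comb (gT : finGroupType) (G : {group gT})
    (D : comUnitRingType) n (f chi : gT -> D) :
    (forall k, k.+1%:R \is a @GRing.unit D) ->
  exists2 p : {poly D}, p \is monic /\ size p = n.+2 &
    forall (E : idomainType) (phi : {rmorphism D -> E})
        (rho : mx_representation E G n.+1),
      {in G, forall g, \tr (rho g) = phi (chi g)} ->
    char_poly (\sum_(g in G) phi (f g) *: rho g) = map_poly phi p.
Proof.
move=> natU.
have [b Db] : exists b : nat -> gT -> D, forall i (E : comUnitRingType)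
    (phi : {rmorphism D -> E}) n (rho : mx_representation E G n.+1),
    (\sum_(g in G) phi (f g) *: rho g) ^+ i = \sum_(g in G) phi (b i g) *: rho
      g.
  by have /choice[b Db] := group_comb_exp G f; exists b.
have [p monp Dp] := char_poly_of_traces n
  (fun i => \sum_(g in G) b i g * chi g) natU.
exists p => // E phi rho Dchi; apply: Dp => i; rewrite Db linear_sum rmorph_sum.
by apply: eq_bigr => g Gg; rewrite linearZ /= rmorphM Dchi.
Qed.

(** * Positivity *)

(** For a row eigenvector v and a column w, the matrix coefficient sending k to v rho(k^-1) w is an
    eigenvector in the regular representation. The unit vector w is chosen to make it nonzero at
    1. *)
Lemma eigenvalue_regular (gT : finGroupType) (G : {group gT}) (F : fieldType)
    n (rho : mx_representation F G n) (h : gT -> F) a :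
    eigenvalue (\sum_(g in G) h g *: rho g) a ->
  eigenvalue (\sum_(g in G) h g *: regular_repr F G g) a.
Proof.
case/eigenvalueP=> v Dv nz_v; have [i nz_vi] : exists i, v 0 i != 0.
  by case/rV0Pn: nz_v => i; exists i.
pose w : 'cV[F]_n := delta_mx i 0.
pose c k := (v *m rho k^-1%g *m w) 0 0.
apply/eigenvalueP; exists (\row_j c (enum_val j)); last first.
  apply: contraNneq nz_vi => /rowP/(_ (gring_index G 1%g)).
  rewrite !mxE gring_indexK ?group1 // /c invg1 repr_mx1 mulmx1 => <-.
  by rewrite -colE mxE.
apply/rowP=> j; rewrite mulmx_sumr summxE [RHS]mxE [in RHS]mxE.
transitivity (((\sum_(g in G) h g *: (v *m rho g)) *m rho (enum_val j)^-1%g *m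
  w) 0 0).
  rewrite !mulmx_suml summxE; apply: eq_bigr => g Gg.
  rewrite -scalemxAr -!scalemxAl [LHS]mxE [RHS]mxE; congr (_ * _).
  have Gj := enum_valP j.
  rewrite mxE (bigD1 (gring_index G (enum_val j * g^-1)%g)) //= big1 =>
    [|k nz_k].
    rewrite mxE [regular_mx _ _ _ _ _]mxE gring_indexK ?groupM ?groupV //.
    rewrite mxE mulgKV gring_valK !eqxx mulr1 addr0.
    by rewrite /c invMg invgK repr_mxM ?groupV // !mulmxA.
  rewrite [X in _ * X]mxE [X in _ * X]mxE eqxx (_ : (j == _) = false) ?mulr0 //.
  apply: contraNF nz_k => /eqP Dj; rewrite -[k]gring_valK Dj.
  by rewrite gring_indexK ?mulgK ?groupM ?enum_valP.
have -> : \sum_(g in G) h g *: (v *m rho g) = a *: v.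
  by rewrite -Dv mulmx_sumr; apply: eq_bigr => g _; rewrite scalemxAr.
by rewrite -!scalemxAl mxE.
Qed.

(** The regular representation acts by permutation matrices, so the transpose of the matrix of g is
    that of g^-1. *)
Lemma regular_odd_comb_skew (gT : finGroupType) (G : {group gT})
    (F : fieldType) (h : gT -> F) : {in G, forall g, h g^-1%g = - h g} ->
  let X := \sum_(g in G) h g *: regular_repr F G g in X^T = - X.
Proof.
move=> odd_h X; rewrite /X linear_sum (reindex_inj invg_inj) -sumrN /=.
apply: eq_big => [g|g]; rewrite groupV // => Gg.
rewrite odd_h // linearZ /= scaleNr; congr (- (_ *: _)).
apply/matrixP=> i j; rewrite !mxE eqxx /=.
congr ((nat_of_bool _)%:R); apply/idP/idP=> /eqP->;
  by rewrite gring_indexK ?mulgK ?mulgKV ?gring_valK // groupM ?groupV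
    ?enum_valP.
Qed.

(** If v X = t v, then t v v^T = v X v^T = 0 by skewness, while v v^T is a nonzero sum of
    squares. *)
Lemma skew_real_eigenvalue (R : realFieldType) n (X : 'M[R]_n) t :
  X^T = - X -> eigenvalue X t -> t = 0.
Proof.
move=> skX /eigenvalueP[v Dv nz_v].
have sq_v : (v *m v^T) 0 0 != 0.
  apply: contra nz_v; rewrite mxE psumr_eq0 => [/allP v0|i _]; last first.
    by rewrite mxE -expr2 sqr_ge0.
  apply/eqP/rowP=> i; have := v0 i (mem_index_enum i).
  by rewrite !mxE -expr2 sqrf_eq0 => /eqP.
have q0 : (v *m X *m v^T) 0 0 = 0.
  have : (v *m X *m v^T)^T = - (v *m X *m v^T).
    by rewrite !trmx_mul trmxK skX mulNmx mulmxN mulmxA.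
  move/matrixP/(_ 0 0)/eqP; rewrite !mxE -subr_eq0 opprK -mulr2n mulrn_eq0 /=.
  by move/eqP.
move/eqP: q0; rewrite Dv -scalemxAl mxE mulf_eq0 (negPf sq_v) orbF.
by move/eqP.
Qed.

(** A monic polynomial is positive far to the right, so a value at most 0 at 0 would force a root by
    the intermediate value theorem. *)
Lemma monic_no_root_gt0 (R : rcfType) (p : {poly R}) :
  p \is monic -> (forall t, ~~ root p t) -> 0 < p`_0.
Proof.
move=> monp noroot; rewrite -horner_coef0 ltNge; apply/negP=> p0_le0.
have lc_gt0 : 0 < lead_coef p by rewrite (monicP monp).
have [x px] := poly_pinfty_gt_lc lc_gt0.
have [||t _ rt] := @poly_ivtW R p 0 (Num.max 0 x).
- by rewrite le_max lexx.
- by rewrite p0_le0 (le_trans (ltW lc_gt0)) // px // le_max lexx orbT.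
by have := noroot t; rewrite rt.
Qed.

(* The roots of [p] are eigenvalues of a skew-symmetric rational matrix, namely
   of the combination acting on the regular representation. *)
Lemma odd_comb_char_poly_gt0 (gT : finGroupType) (G : {group gT})
    (K : fieldType) (sigma : {rmorphism K -> algC}) n
    (rho : mx_representation algC G n) (h : gT -> int) (p : {poly K})
    (R : rcfType) (tau : {rmorphism K -> R}) :
    {in G, forall g, h g^-1%g = - h g} -> p \is monic -> p`_0 != 0 ->
    char_poly (\sum_(g in G) (h g)%:~R *: rho g) = map_poly sigma p ->
  0 < tau p`_0.
Proof.
move=> odd_h monp nz_p0 Dp.
pose X (F : fieldType) := \sum_(g in G) (h g)%:~R *: regular_repr F G g.
have mapX (E F : fieldType) (f : {rmorphism E -> F}) : map_mx f (X E) = X F.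
  rewrite map_mx_sum; apply: eq_bigr => g _.
  by rewrite map_mxZ rmorph_int; congr (_ *: _); apply: map_regular_mx.
have [r Dr] := closed_field_poly_normal (map_poly sigma p).
rewrite lead_coef_map (monicP monp) rmorph1 scale1r in Dr.
(* The power [size r] absorbs repeated roots of [p]. Divisibility is checked over [algC] but holds
   already over K, from where it can be carried along [tau]. *)
have dv_p : p %| char_poly (X K) ^+ size r.
  rewrite -(dvdp_map sigma) rmorphXn /= map_char_poly mapX Dr.
  have : all (root (char_poly (X algC))) r.
    apply/allP=> a ra; rewrite -eigenvalue_root_char.
    apply: (eigenvalue_regular (rho := rho)).
    by rewrite eigenvalue_root_char Dp Dr root_prod_XsubC.
  elim: (r) => [|a s IHs] /=; first by rewrite big_nil dvd1p.
  by case/andP=> ra /IHs dv_s; rewrite big_cons exprS dvdp_mul // dvdp_XsubCl.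
rewrite -coef_map; apply: monic_no_root_gt0 => [|t]; first by rewrite map_monic.
apply: contra nz_p0 => rt.
have: root (char_poly (X R) ^+ size r) t.
  move: dv_p; rewrite -(dvdp_map tau) rmorphXn /= map_char_poly mapX.
  by case/dvdpP=> s ->; rewrite rootM rt orbT.
move=> rtX; have t0 : t = 0.
  apply: (@skew_real_eigenvalue _ _ (X R)).
    apply: (@regular_odd_comb_skew _ G R (fun g => (h g)%:~R)) => g Gg.
    by rewrite odd_h // rmorphN.
  rewrite eigenvalue_root_char; move: rtX; rewrite /root horner_exp expf_eq0.
  by case/andP.
by move: rt; rewrite t0 /root horner_coef0 coef_map fmorph_eq0.
Qed.

(** * A splitting field in which K is closed under square roots *)

Lemma fraction_quotient (R : idomainType) (x : {fraction R}) :
  exists2 d : R, d != 0 & exists a : R, x * tofrac d = tofrac a.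
Proof.
elim/quotW: x => y; exists \d_y; first exact: denom_ratioP.
exists \n_y; unlock FracField.tofrac.
rewrite -[LHS]FracField.pi_mul; apply/eqmodP => /=.
rewrite FracField.equivfE /FracField.mulf /= !numden_Ratio ?(oner_neq0, mulr1,
  mul1r) //.
all: by rewrite ?denom_ratioP // mulrC.
Qed.

Lemma clear_denominators (R : idomainType) (F : fieldType)
    (f : {rmorphism R -> F}) :
    (forall x, exists2 d, d != 0 & exists a, x * f d = f a) ->
  forall q : {poly F}, exists2 d, d != 0 & exists q1, f d *: q = map_poly f q1.
Proof.
move=> fracF; elim/poly_ind=> [|q c [d nz_d [q1 Dq]]].
  by exists 1; rewrite ?oner_neq0 //; exists 0;
    rewrite scaler0 map_polyC /= rmorph0.
have [b nz_b [a Dc]] := fracF c.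
exists (d * b); first by rewrite mulf_neq0.
exists (b *: q1 * 'X + (d * a)%:P).
rewrite [RHS](_ : _ = f b *: map_poly f q1 * 'X + (f (d * a))%:P).
  rewrite -Dq scalerDr !rmorphM -Dc scalerAl scalerA [f b * _]mulrC.
  by congr (_ + _); rewrite -!mul_polyC -!polyCM -mulrA [f b * c]mulrC.
rewrite rmorphD /= map_polyC /=; congr (_ + _).
by rewrite rmorphM /= map_polyZ map_polyX.
Qed.

(** Extracts the content with respect to the inner variable alone: after swapping the two variables,
    its exponent is the multiplicity of the root 0. *)
Lemma primitive_at0 (C : fieldType) (q : {poly {poly C}}) : q != 0 ->
  exists k q1, q = ('X^k)%:P * q1 /\ map_poly (horner_eval 0) q1 != 0.
Proof.
move=> nz_q; have [k [q1 nz Dq]] := multiplicity_XsubC (swapXY q) 0.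
rewrite swapXY_eq0 nz_q /= in nz.
exists k, (swapXY q1); split.
  rewrite -[q]swapXYK Dq polyC0 subr0 rmorphM rmorphXn /= swapXY_X mulrC.
  by rewrite rmorphXn.
apply: contra nz => /eqP h0; rewrite /root -[q1]swapXYK -polyC0 horner_swapXY.
by rewrite h0.
Qed.

(* F is the field of fractions of C[u], and u is the Eisenstein prime. *)
Lemma eisenstein_irreducible (C F : fieldType) (f : {rmorphism {poly C} -> F})
    n (P H : {poly {poly C}}) :
    injective f -> (forall x, exists2 d, d != 0 & exists a, x * f d = f a) ->
    P \is monic -> size P = n.+2 ->
    P = 'X^(n.+1) - 'X%:P + ('X^2)%:P * H ->
  irreducible_poly (map_poly f P).
Proof.
move=> f_inj fracF monP szP DP.
have f_eq0 a : (f a == 0) = (a == 0).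
  by apply/eqP/eqP=> [|->]; rewrite -?(rmorph0 f) // => /f_inj.
have szf (q : {poly {poly C}}) : size (map_poly f q) = size q.
  by rewrite size_map_inj_poly // rmorph0.
have nzP : map_poly f P != 0 by rewrite -size_poly_eq0 szf szP.
split=> [|q sz_q /dvdpP[r DPqr]]; first by rewrite szf szP.
have [nz_r nz_q] : r != 0 /\ q != 0.
  by move: nzP; rewrite DPqr mulf_eq0 negb_or => /andP.
rewrite -dvdp_size_eqp; last by rewrite DPqr dvdp_mull.
have szPqr : size P = (size r + size q).-1 by rewrite -szf DPqr size_mul.
have {sz_q}sz_q : (1 < size q)%N by rewrite ltn_neqAle eq_sym sz_q
  size_poly_gt0.
apply/contraT; rewrite szf => ne_sz.
have {ne_sz} sz_r : (1 < size r)%N.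
  have : (0 < size r)%N by rewrite size_poly_gt0.
  rewrite leq_eqVlt => /predU1P[sz1|//].
  by rewrite szPqr -sz1 eqxx in ne_sz.
(* Every factor over F can be scaled to have coefficients in C[u], not all divisible by u. *)
have primitive (s : {poly F}) : s != 0 ->
    exists2 b : F, b != 0 & exists s1 : {poly {poly C}},
      b *: s = map_poly f s1 /\ map_poly (horner_eval 0) s1 != 0.
  move=> nz_s; have [d nz_d [s1 Ds]] := clear_denominators fracF s.
  have nz_s1 : s1 != 0.
    rewrite -size_poly_eq0 -szf -Ds size_poly_eq0.
    by rewrite scaler_eq0 negb_or f_eq0 nz_d.
  have [k [s2 [Ds1 nz_s2]]] := primitive_at0 nz_s1.
  have nzXk : f 'X^k != 0 by rewrite f_eq0 monic_neq0 ?monicXn.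
  exists ((f 'X^k)^-1 * f d); first by rewrite mulf_eq0 invr_eq0 negb_or nzXk
    f_eq0.
  exists s2; split=> //; rewrite -scalerA Ds Ds1 rmorphM /= map_polyC /=.
  by rewrite mul_polyC scalerA mulVf // scale1r.
have [b nz_b [q1 [Dq nz_q1]]] := primitive _ nz_q.
have [c nz_c [r1 [Dr nz_r1]]] := primitive _ nz_r.
(* The scalar b c of F lies in C[u], since P is monic and r1 q1 has coefficients in C[u]. *)
pose g := lead_coef (r1 * q1).
have DgP : g *: P = r1 * q1.
  apply: (map_inj_poly f_inj (rmorph0 f)); rewrite /= map_polyZ.
  rewrite rmorphM /= -Dq -Dr -scalerAl -scalerAr scalerA -DPqr.
  congr (_ *: _); rewrite /g -(lead_coef_map_inj f_inj (rmorph0 f)).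
  rewrite rmorphM /= -Dq -Dr -scalerAl -scalerAr scalerA -DPqr lead_coefZ.
  by rewrite (lead_coef_map_inj f_inj (rmorph0 f)) (monicP monP) rmorph1 mulr1.
have sz1 (s : {poly F}) b1 s1 : b1 != 0 ->
    b1 *: s = map_poly f s1 -> size s1 = size s.
  by move=> nz_b1 Ds; rewrite -szf -Ds size_scale.
have szq1 := sz1 _ _ _ nz_b Dq; have szr1 := sz1 _ _ _ nz_c Dr.
pose q0 := map_poly (horner_eval 0) q1; pose r0 := map_poly (horner_eval 0) r1.
(* Reduction modulo u turns P into x^(n+1). *)
have Dqr0 : g.[0] *: 'X^(n.+1) = r0 * q0.
  rewrite /q0 /r0 -rmorphM /= -DgP map_polyZ; congr (_ *: _).
  rewrite DP rmorphD rmorphB rmorphM /= map_polyXn !map_polyC /=.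
  by rewrite !horner_evalE hornerX hornerXn expr0n polyC0 mul0r addr0 subr0.
have nz_g : g.[0] != 0.
  by apply: contraTneq (mulf_neq0 nz_r1 nz_q1) => g0;
    rewrite -Dqr0 g0 scale0r eqxx.
(* If s did not vanish at 0, then x^(n+1) would divide t, whose degree is too small. *)
have root0 (s t : {poly C}) : g.[0] *: 'X^(n.+1) = s * t -> t != 0 ->
  (size t < n.+2)%N -> root s 0.
  move=> Dst nz_t sz_t; apply: contraLR sz_t => nr0.
  have : 'X^(n.+1) %| s * t by rewrite -Dst dvdpZr.
  rewrite Gauss_dvdpr; last by rewrite coprimep_expl // coprimep_sym coprimepX.
  by move/(dvdp_leq nz_t); rewrite size_polyXn -leqNgt.
have sz_lt (s t : {poly F}) (t1 : {poly {poly C}}) : (1 < size s)%N ->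
  (0 < size t)%N ->
    size P = (size s + size t).-1 -> size t1 = size t ->
    (size (map_poly (horner_eval (0 : C)) t1) < n.+2)%N.
  move=> s1 t0; rewrite szP => -> Dt; apply: leq_ltn_trans (size_poly _ _) _.
  by rewrite Dt; case: (size s) s1 => [|[|k]] // _; rewrite addSn ltnS leq_addl.
have q00 : root q0 0.
  apply: (root0 q0 r0) nz_r1 _; first by rewrite Dqr0 [LHS]mulrC.
  by apply: sz_lt sz_q _ _ szr1; rewrite ?size_poly_gt0 // addnC.
have r00 : root r0 0.
  by apply: (root0 r0 q0) nz_q1 _ => //; apply: sz_lt sz_r _ _ szq1;
    rewrite ?size_poly_gt0.
have coef0X (s : {poly {poly C}}) : root (map_poly (horner_eval 0) s) 0 ->
    exists s', s`_0 = s' * 'X.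
  rewrite /root horner_coef0 coef_map /= horner_evalE => /factor_theorem[s' ->].
  by exists s'; rewrite subr0.
have [q' Dq'] := coef0X _ q00; have [r' Dr'] := coef0X _ r00.
(* Both constant coefficients are divisible by u, hence u^2 divides g(-u + u^2 H_0). Cancelling one
   u and setting u = 0 gives g(0) = 0, a contradiction. *)
have := congr1 (fun s : {poly {poly C}} => s`_0) DgP.
rewrite coef0M Dq' Dr' coefZ DP !coefD coefN coefXn coefC coefCM /= sub0r.
have -> : g * (- 'X + 'X^2 * H`_0) = (g * (-1 + 'X * H`_0)) * 'X.
  by rewrite -mulrA mulrDl mulN1r; congr (_ * (_ + _)); rewrite [RHS]mulrAC.
rewrite [RHS]mulrA => /(mulIf (negbT (polyX_eq0 _))) /(congr1 (fun s => s.[0])).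
by rewrite !hornerE => /eqP; rewrite mulrN1 oppr_eq0 (negPf nz_g).
Qed.

(** * The subfield of fractions of the image of a ring homomorphism *)

Section FractionImage.
Variables (D : comNzRingType) (E : fieldType) (psi : {rmorphism D -> E}).

(** The existential is made boolean classically, so that the subfield can be formed as a subtype of
    E. *)
Definition fraction_image : {pred E} :=
  fun x => `[< exists a b, psi b != 0 /\ x = psi a / psi b >].

Lemma fraction_imageP x :
  reflect (exists a b, psi b != 0 /\ x = psi a / psi b) (x \in fraction_image).
Proof. exact: asboolP. Qed.

Fact fraction_image_divring : divring_closed fraction_image.
Proof.
split.
- by apply/fraction_imageP; exists 1, 1; rewrite rmorph1 oner_neq0 divr1.
- move=> _ _ /fraction_imageP[a [b [nz_b ->]]] /fraction_imageP[c [d [nz_d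
  ->]]].
  apply/fraction_imageP; exists (a * d - c * b), (b * d).
  split; first by rewrite rmorphM mulf_neq0.
  by rewrite -mulNr addf_div // rmorphB !rmorphM mulNr.
- move=> _ _ /fraction_imageP[a [b [nz_b ->]]] /fraction_imageP[c [d [nz_d
  ->]]].
  have [->|nz_c] := eqVneq (psi c) 0.
    apply/fraction_imageP; exists 0, 1.
    by rewrite rmorph0 rmorph1 oner_neq0 !mul0r invr0 mulr0.
  apply/fraction_imageP; exists (a * d), (b * c).
  split; first by rewrite rmorphM mulf_neq0.
  by rewrite invf_div mulf_div !rmorphM.
Qed.
HB.instance Definition _ :=
  GRing.isDivringClosed.Build E fraction_image fraction_image_divring.

Record fraction_field := FractionField {
  fraction_val :> E;
  _ : fraction_val \in fraction_image
}.
HB.instance Definition _ := [isSub for fraction_val].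
HB.instance Definition _ := [Choice of fraction_field by <:].
HB.instance Definition _ := [SubChoice_isSubIntegralDomain of fraction_field
  by <:].
HB.instance Definition _ := [SubIntegralDomain_isSubField of fraction_field by
  <:].

Fact mem_fraction_image a : psi a \in fraction_image.
Proof. by apply/fraction_imageP; exists a, 1;
  rewrite rmorph1 oner_neq0 divr1. Qed.

Definition to_fraction a : fraction_field := FractionField (mem_fraction_image
  a).

Fact to_fraction_zmod_morphism : zmod_morphism to_fraction.
Proof. by move=> a b; apply: val_inj; rewrite /= rmorphB. Qed.
HB.instance Definition _ := GRing.isZmodMorphism.Build D fraction_field
  to_fraction
  to_fraction_zmod_morphism.
Fact to_fraction_monoid_morphism : monoid_morphism to_fraction.
Proof. by split=> [|a b]; apply: val_inj; rewrite /= ?rmorph1 ?rmorphM. Qed.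
HB.instance Definition _ := GRing.isMonoidMorphism.Build D fraction_field
  to_fraction
  to_fraction_monoid_morphism.
End FractionImage.

Lemma image_fraction_field (D : comNzRingType) (E : fieldType)
    (psi : {rmorphism D -> E}) :
  exists (L : fieldType) (j : {rmorphism L -> E}) (psiL : {rmorphism D -> L}),
    (forall a, j (psiL a) = psi a) /\
    (forall x, exists a b, psi b != 0 /\ j x = psi a / psi b).
Proof.
exists (fraction_field psi), (\val : {rmorphism fraction_field psi ->
  E}), (@to_fraction D E psi).
by split=> // x; apply/fraction_imageP; case: x.
Qed.

(* A polynomial over Q can be prescribed up to first order at a generator of
   a number field, since the minimal polynomial has a simple root there. *)
Lemma rat_poly_jets (I : finType) (c c' : I -> algC) :
  exists (theta : algC) (f : I -> {poly rat}), forall i,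
    (map_poly ratr (f i)).[theta] = c i /\
    ((map_poly ratr (f i))^`()).[theta] = c' i.
Proof.
pose s := [seq c i | i <- enum I] ++ [seq c' i | i <- enum I].
have [theta _ [ps Ds]] := algC_PET s; exists theta.
pose ev (p : {poly rat}) : algC := (map_poly ratr p).[theta].
have evD p q : ev (p + q) = ev p + ev q by rewrite /ev rmorphD hornerD.
have evM p q : ev (p * q) = ev p * ev q by rewrite /ev rmorphM hornerM.
have evN p : ev (- p) = - ev p by rewrite /ev rmorphN hornerN.
have inQ x : x \in s -> exists p, ev p = x.
  by rewrite Ds => /mapP[p _ ->]; exists p.
have [mu [_ mon_mu] dv_mu] := minCpolyP theta.
have mu0 : ev mu = 0 by apply/eqP; rewrite -[_ == _]/(root _ _) dv_mu.
have nz_mu : mu != 0 by rewrite monic_neq0.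
have sz_mu : (1 < size mu)%N.
  rewrite -(size_map_poly (@ratr algC)).
  by apply: (root_size_gt1 _ (a := theta)); rewrite ?map_poly_eq0 // dv_mu.
have nz_mu' : mu^`() != 0.
  apply: contraTneq sz_mu => /polyP/(_ (size mu).-2).
  rewrite coef_deriv coef0 -mulr_natl => /eqP; rewrite mulf_eq0 pnatr_eq0 /=.
  case: (size mu) (lead_coefE mu) => [|[|m]] //= <-.
  by rewrite lead_coef_eq0 (negPf nz_mu).
have cop : coprimep mu mu^`().
  rewrite -gcdp_eqp1 -size_poly_eq1.
  have /dvdpP[q Dq] := dvdp_gcdl mu mu^`(); set g := gcdp _ _ in Dq *.
  have := mu0; rewrite Dq evM => /eqP; rewrite mulf_eq0 => /orP[].
    rewrite -[_ == _]/(root _ _) dv_mu => /dvdp_leq le_mu.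
    have [nz_q nz_g] : q != 0 /\ g != 0.
      by move: nz_mu; rewrite Dq mulf_eq0 negb_or => /andP.
    have := le_mu nz_q; rewrite Dq size_mul //.
    have : (0 < size g)%N by rewrite size_poly_gt0.
    case: (size g) => [|[|k]] // _; rewrite addnS addnS /=.
    by rewrite ltnNge leq_addr.
  rewrite -[_ == _]/(root _ _) dv_mu => dv_g.
  have /dvdp_leq : mu %| mu^`() by apply: dvdp_trans dv_g (dvdp_gcdr _ _).
  by move/(_ nz_mu'); rewrite leqNgt lt_size_deriv.
(* [v] represents the inverse of mu'(theta). *)
have [v Dv] : exists v, ev v * ev mu^`() = 1.
  have /Bezout_coprimepP[[u v] /= /eqp_size] := cop.
  rewrite size_poly1 => /eqP/size_poly1P[a nz_a Da].
  exists (a^-1%:P * v); have := congr1 ev Da.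
  rewrite evD !evM mu0 mulr0 add0r /ev !map_polyC /= !hornerC -mulrA => ->.
  by rewrite -rmorphM mulVf ?rmorph1.
have jet i : exists f, (ev f = c i) /\ (((map_poly ratr f)^`()).[theta] = c' i).
  have [a Da] : exists a, ev a = c i.
    by apply: inQ; rewrite mem_cat map_f ?mem_enum.
  have [b Db] : exists b, ev b = c' i.
    by apply: inQ; rewrite mem_cat [X in _ || X]map_f ?orbT ?mem_enum.
  (* The correction vanishes at theta with mu, and its derivative there is mu'(theta) v(theta) (b -
     a')(theta) = (b - a')(theta). *)
  exists (a + mu * ((b - a^`()) * v)); split.
    by rewrite evD evM mu0 mul0r addr0.
  rewrite deriv_map -/(ev _) derivD derivM !(evD, evM) evN.
  by rewrite mu0 mul0r addr0 Db mulrC -mulrA Dv mulr1 addrC subrK.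
by have [f Df] := choice jet; exists f.
Qed.

Lemma companion_exists (R : comNzRingType) n (p : {poly R}) :
  p \is monic -> size p = n.+1 -> exists M : 'M[R]_n, char_poly M = p.
Proof.
move=> monp szp; have := companionmxK monp.
by move: (companionmx p); rewrite szp => M; exists M.
Qed.

(** The determinant of A + xB is a polynomial in x with value det A at 0, so the factor theorem
    applies. *)
Lemma det_congruent (R : comNzRingType) n (A B : 'M[R]_n) d :
  exists h, \det (A + d *: B) = \det A + d * h.
Proof.
rewrite -horner_det_pencil; set p := \det _.
have -> : \det A = p.[0] by rewrite horner_det_pencil scale0r addr0.
have /factor_theorem[q Dq] : root (p - p.[0]%:P) 0.
  by rewrite /root !hornerE subrr.
exists q.[d]; have /eqP := congr1 (horner^~ d) Dq.
rewrite /= hornerD hornerN hornerC hornerM hornerXsubC subr0 subr_eq => /eqP->.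
by rewrite addrC mulrC.
Qed.

(** * Descent of representations and invariant forms to a subfield *)

(** Any row y is v times a matrix, and by absolute irreducibility every matrix is a combination of
    the rho(g). *)
Lemma abs_irr_cyclic_row (gT : finGroupType) (G : {group gT}) (F : fieldType)
    n (rho : mx_representation F G n) (v : 'rV[F]_n) :
    mx_absolutely_irreducible rho -> v != 0 ->
  row_full (\matrix_(i < #|G|) (v *m rho (enum_val i))).
Proof.
case/mx_abs_irrP=> _ [a Da] /rV0Pn[i nz_vi].
rewrite -sub1mx; apply/row_subP=> k; set y := row k _.
have -> : y = v *m ((v 0 i)^-1 *: (delta_mx i 0 *m y)).
  by rewrite -scalemxAr mulmxA -colE [col i v]mx11_scalar mxE mul_scalar_mx
    scalerA mulVf ?scale1r.
rewrite (Da (_ *: _)) mulmx_sumr summx_sub // => x Gx.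
rewrite -scalemxAr scalemx_sub //.
by rewrite (eq_row_sub (enum_rank_in Gx x)) // rowK enum_rankK_in.
Qed.

Lemma abs_irr_cyclic_col (gT : finGroupType) (G : {group gT}) (F : fieldType)
    n (rho : mx_representation F G n) (u : 'cV[F]_n) :
    mx_absolutely_irreducible rho -> u != 0 ->
  row_full (\matrix_(i < #|G|) (rho (enum_val i) *m u)^T).
Proof.
case/mx_abs_irrP=> _ [a Da] nz_u.
have [i nz_ui] : exists i, u i 0 != 0.
  by move: nz_u; rewrite -(inj_eq trmx_inj) trmx0 => /rV0Pn[i]; rewrite mxE;
    exists i.
rewrite -sub1mx; apply/row_subP=> k; set y := row k _.
have -> : y = (((u i 0)^-1 *: (y^T *m delta_mx 0 i)) *m u)^T.
  rewrite -scalemxAl -mulmxA -rowE [row i u]mx11_scalar mxE mul_mx_scalar.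
  by rewrite scalerA mulVf ?scale1r ?trmxK.
rewrite (Da (_ *: _)) mulmx_suml linear_sum summx_sub // => x Gx.
rewrite -scalemxAl linearZ scalemx_sub //.
by rewrite (eq_row_sub (enum_rank_in Gx x)) // rowK enum_rankK_in.
Qed.

(* If R = u v has rank one, then the matrices of rho in the basis of the rows
   v rho(g_i) are computed from the numbers v rho(g) u = tr(R rho(g)). *)
Lemma repr_descent (gT : finGroupType) (G : {group gT}) (L E : fieldType)
    (j : {rmorphism L -> E}) n (rho : mx_representation E G n)
    (u : 'cV[E]_n) (v : 'rV[E]_n) :
    mx_absolutely_irreducible rho -> u *m v != 0 ->
    {in G, forall g, exists y, \tr (u *m v *m rho g) = j y} ->
  exists rL : mx_representation L G n, exists2 P, P \in unitmx &
    {in G, forall g, map_mx j (rL g) = P *m rho g *m invmx P}.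
Proof.
move=> irr nz_uv inL.
have nz_v : v != 0 by apply: contraNneq nz_uv => ->; rewrite mulmx0.
have nz_u : u != 0 by apply: contraNneq nz_uv => ->; rewrite mul0mx.
have fullv := abs_irr_cyclic_row irr nz_v.
have fullu := abs_irr_cyclic_col irr nz_u.
pose a i : gT := enum_val (fullrankfun fullv i).
pose b i : gT := enum_val (fullrankfun fullu i).
have Ga i : a i \in G by apply: enum_valP.
have Gb i : b i \in G by apply: enum_valP.
pose P := \matrix_i (v *m rho (a i)); pose Q := \matrix_i (rho (b i) *m u)^T.
have uP : P \in unitmx.
  rewrite -row_full_unit /row_full -[X in _ == X](mxrank_fullrowsub fullv).
  by apply/eqP; congr (\rank _); apply/row_matrixP=> i;
    rewrite row_rowsub !rowK.
have uQ : Q^T \in unitmx.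
  rewrite unitmx_tr -row_full_unit /row_full -[X in _ == X](mxrank_fullrowsub
    fullu).
  by apply/eqP; congr (\rank _); apply/row_matrixP=> i;
    rewrite row_rowsub !rowK.
have [y Dy] : exists y : gT -> L, {in G, forall g, \tr (u *m v *m rho g) = j
  (y g)}.
  have : forall g, exists x, g \in G -> \tr (u *m v *m rho g) = j x.
    by move=> g; have [/inL[x Dx]|] := boolP (g \in G); [exists x | exists 0].
  by case/choice=> y Dy; exists y.
(* The entries v rho(a_i g b_k) u lie in L. Since [Gam g] maps to P rho(g) Q^T, the factor Q^T
   cancels in the quotient by [Gam 1%g]. *)
pose Gam g : 'M[L]_n := \matrix_(i, k) y (a i * g * b k)%g.
have mapGam g : g \in G -> map_mx j (Gam g) = P *m rho g *m Q^T.
  move=> Gg; apply/matrixP=> i k; rewrite !mxE -Dy ?groupM //.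
  rewrite !repr_mxM ?groupM // -mulmxA mxtrace_mulC.
  transitivity ((v *m rho (a i) *m rho g *m (rho (b k) *m u)) 0 0).
    by rewrite -trace_mx11 !mulmxA.
  rewrite [LHS]mxE; apply: eq_bigr => l _;
    rewrite [Q^T _ _]mxE [Q _ _]mxE [_^T _ _]mxE.
  congr (_ * _); rewrite [LHS]mxE [RHS]mxE; apply: eq_bigr => m _.
  by rewrite [P _ _]mxE.
have uG1 : Gam 1%g \in unitmx.
  by rewrite -(map_unitmx j) mapGam // repr_mx1 mulmx1 unitmx_mul uP.
pose r g := Gam g *m invmx (Gam 1%g).
have mapr g : g \in G -> map_mx j (r g) = P *m rho g *m invmx P.
  move=> Gg; rewrite map_mxM map_invmx !mapGam // repr_mx1 mulmx1.
  have uPQ : P *m Q^T \in unitmx by rewrite unitmx_mul uP.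
  by rewrite -[RHS](mulmxK uPQ); congr (_ *m _); rewrite mulmxA mulmxKV.
have r_repr : mx_repr G r.
  split=> [|g h Gg Gh]; first by rewrite /r mulmxV.
  apply: (map_mx_inj (f := j)); rewrite [RHS]map_mxM !mapr ?groupM // repr_mxM
    //.
  by rewrite !mulmxA mulmxKV.
by exists (MxRepresentation r_repr), P.
Qed.

Lemma invariant_form_average (gT : finGroupType) (G : {group gT})
    (F : fieldType) n (rho : mx_representation F G n) (S : 'M[F]_n) :
  S^T = S -> invariant_form rho (\sum_(g in G) rho g *m S *m (rho g)^T).
Proof.
move=> symS; split=> [|h Gh].
  rewrite linear_sum; apply: eq_bigr => g _ /=.
  by rewrite !trmx_mul trmxK symS mulmxA.
rewrite mulmx_sumr mulmx_suml [RHS](reindex_inj (mulgI h)) /=.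
apply: eq_big => [g|g Gg]; first by rewrite groupMl.
by rewrite repr_mxM // trmx_mul !mulmxA.
Qed.

(* Averages of matrices defined over [L] already span all invariant forms. *)
Lemma invariant_form_descent (gT : finGroupType) (G : {group gT})
    (L E : fieldType) (j : {rmorphism L -> E}) n
    (rho : mx_representation E G n) (rL : mx_representation L G n) P B :
    #|G|%:R != 0 :> E -> 2%:R != 0 :> E ->
    {in G, forall g, map_mx j (rL g) = P *m rho g *m invmx P} ->
    P \in unitmx -> invariant_form rho B -> B != 0 ->
  exists2 B' : 'M[L]_n, invariant_form rL B' & B' != 0.
Proof.
move=> nzG nz2 DrL uP invB nzB.
(* [C] is the form B in the basis of the descended representation. *)
pose C := P *m B *m P^T.
have symC : C^T = C by rewrite /C !trmx_mul trmxK (proj1 invB) mulmxA.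
have nzC : C != 0.
  apply: contraNneq nzB => C0; apply/eqP.
  apply: (can_inj (mulKmx uP)); rewrite mulmx0.
  by apply: (can_inj (mulmxK (_ : P^T \in unitmx)));
    rewrite ?unitmx_tr // mul0mx.
have invC g : g \in G -> map_mx j (rL g) *m C *m (map_mx j (rL g))^T = C.
  move=> Gg; rewrite DrL // !trmx_mul trmx_inv /C !mulmxA mulmxKV //.
  rewrite -[RHS]mulmxA -{2}(proj2 invB g Gg) !mulmxA.
  by rewrite -!mulmxA [P^T *m _]mulmxA mulmxV ?unitmx_tr // mul1mx.
pose avg (F : fieldType) (r : gT -> 'M[F]_n) (S : 'M[F]_n) :=
  \sum_(g in G) r g *m S *m (r g)^T.
pose rE g := map_mx j (rL g).
have avgC : avg E rE C = #|G|%:R *: C.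
  rewrite /avg (eq_bigr (fun=> C)) => [|g Gg]; last exact: invC.
  by rewrite sumr_const scaler_nat.
pose S (F : fieldType) (p : 'I_n * 'I_n) : 'M[F]_n :=
  delta_mx p.1 p.2 + (delta_mx p.1 p.2)^T.
have [/existsP[p nz_p]|] := boolP [exists p, avg L rL (S L p) != 0].
  exists (avg L rL (S L p)) => //; apply: invariant_form_average.
  by rewrite /S linearD /= trmxK addrC.
rewrite negb_exists => /forallP avg0; case/negP: nzC.
(* C + C^T is a combination of the symmetric matrices [S E p], defined over L. If all their averages
   vanish, so does its own average, the multiple of it by the group order. *)
have : #|G|%:R *: (C + C^T) = 0.
  have -> : #|G|%:R *: (C + C^T) = #|G|%:R *: C + (#|G|%:R *: C)^T.
    by rewrite linearZ /= -scalerDr.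
  rewrite -avgC.
  have DC : C + C^T = \sum_p C p.1 p.2 *: S E p.
    under eq_bigr => p _ do rewrite scalerDr.
    rewrite big_split /= {1}[C]matrix_sum_delta pair_bigA; congr (_ + _).
    rewrite {1}[C]matrix_sum_delta pair_bigA linear_sum.
    by apply: eq_bigr => p _; rewrite linearZ.
  have avgL : avg E rE (C + C^T) = 0.
    rewrite DC /avg; under eq_bigr => g _ do rewrite mulmx_sumr mulmx_suml.
    rewrite exchange_big /= big1 // => p _.
    under eq_bigr => g _ do rewrite -scalemxAr -scalemxAl.
    rewrite -scaler_sumr [X in _ *: X](_ : _ = map_mx j (avg L rL (S L p))).
      by have /negPn/eqP-> := avg0 p; rewrite map_mx0 scaler0.
    rewrite map_mx_sum; apply: eq_bigr => g _.
    rewrite /rE !map_mxM -map_trmx; congr (_ *m _ *m _).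
    by rewrite /S map_mxD -map_trmx map_delta_mx.
  rewrite -{}avgL /avg linear_sum -big_split /=.
  by apply: eq_bigr => g _; rewrite mulmxDr mulmxDl !trmx_mul trmxK mulmxA.
rewrite symC -mulr2n -scaler_nat scalerA => /eqP.
by rewrite scaler_eq0 mulf_eq0 (negPf nzG) (negPf nz2).
Qed.

(** * The Eisenstein extension and the splitting field *)

(** [E] adjoins a root z of P to the field of fractions of C[u]. A polynomial vanishing at z is not
    coprime to the irreducible P, so it is divisible by P. *)
Lemma eisenstein_root_field (C : fieldType) n (P H : {poly {poly C}}) :
    P \is monic -> size P = n.+2 ->
    P = 'X^(n.+1) - 'X%:P + ('X^2)%:P * H ->
  exists (E : fieldType) (f : {rmorphism {poly C} -> E}) (z : E),
    (map_poly f P).[z] = 0 /\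
    forall b : {poly {poly C}}, (size b < size P)%N ->
      (map_poly f b).[z] = 0 -> b = 0.
Proof.
move=> monP szP DP.
suffices from_irr (F : fieldType) (tf : {rmorphism {poly C} -> F}) :
    injective tf -> irreducible_poly (map_poly tf P) ->
  exists (E : fieldType) (f : {rmorphism {poly C} -> E}) (z : E),
    (map_poly f P).[z] = 0 /\
    forall b : {poly {poly C}}, (size b < size P)%N ->
      (map_poly f b).[z] = 0 -> b = 0.
  have tf_inj : injective (@tofrac {poly C}).
    by move=> a b /eqP; rewrite tofrac_eq => /eqP.
  exact: (from_irr _ (@tofrac {poly C}) tf_inj
    (eisenstein_irreducible tf_inj (@fraction_quotient {poly C}) monP szP DP)).
move=> tf_inj irrP.
have [E _ [z rz _]] := irredp_FAdjoin irrP.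
exists E, (in_alg E \o tf), z; split.
  by rewrite map_poly_comp; apply/eqP.
move=> b sz_b; rewrite map_poly_comp => /eqP rb.
have nzP : map_poly tf P != 0 by rewrite -size_poly_eq0 size_map_inj_poly ?szP
  // rmorph0.
have szf (q : {poly {poly C}}) : size (map_poly tf q) = size q.
  by rewrite size_map_inj_poly // rmorph0.
have dv : map_poly tf P %| map_poly tf b.
  have [//|ndv] := boolP (_ %| _); have [_ irr] := irrP.
  have : coprimep (map_poly tf P) (map_poly tf b).
    rewrite /coprimep; apply: contraR ndv => ne1.
    by rewrite -(eqp_dvdl _ (irr _ ne1 (dvdp_gcdl _ _))) dvdp_gcdr.
  rewrite -(coprimep_map (in_alg E)) => /coprimep_root/(_ rz).
  by rewrite (eqP rb) eqxx.
apply: contraTeq sz_b => nz_b; rewrite -leqNgt -szf -(szf b) dvdp_leq //.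
by rewrite -size_poly_eq0 szf size_poly_eq0.
Qed.

(* The characteristic polynomial is that of the companion matrix of
   [x ^ n - u] modulo [u ^ 2], for the local parameter [u = t - theta]. *)
Lemma eisenstein_combination (gT : finGroupType) (G : {group gT}) n
    (rho : mx_representation algC G n.+1)
    (K : fieldExtType rat) (sigma : {rmorphism K -> algC}) :
    mx_absolutely_irreducible rho ->
  exists (theta : algC) (f : gT -> {poly K}) (H : {poly {poly algC}}),
    char_poly (\sum_(g in G)
        (map_poly sigma (f g) \Po ('X + theta%:P)) *: map_mx polyC (rho g)) =
      'X^(n.+1) - 'X%:P + ('X^2)%:P * H.
Proof.
move=> irr; have [M DM] : exists M : 'M_n.+1, char_poly M = 'X^(n.+1) - 'X%:P
  :> {poly {poly algC}}.
  by apply: companion_exists; rewrite ?monicXnsubC ?size_XnsubC.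
have /mx_abs_irrP[_ [a Da]] := irr.
(* The constant and linear coefficients in u of M are expanded in the rho(g); prescribing these as
   f_g(theta) and f_g'(theta) makes T congruent to M modulo u^2. *)
have [theta [f Df]] := rat_poly_jets (fun g =>
  a g (map_mx (fun q : {poly algC} => q`_0) M))
  (fun g => a g (map_mx (fun q : {poly algC} => q`_1) M)).
exists theta, (fun g => map_poly (in_alg K) (f g)).
set T := \sum_(g in G) _.
have coefT i k l : (T i k)`_l =
    \sum_(g in G) (map_poly ratr (f g) \Po ('X + theta%:P))`_l * rho g i k.
  rewrite summxE coef_sum; apply: eq_bigr => g _; rewrite !mxE coefMC.
  rewrite -map_poly_comp; congr ((_ \Po _)`_l * _).
  by apply: eq_map_poly => x; apply: (fmorph_eq_rat (sigma \o in_alg K)).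
have T0 i k : (T i k)`_0 = (M i k)`_0.
  transitivity (map_mx (fun q : {poly algC} => q`_0) M i k);
    last by rewrite mxE.
  rewrite coefT [RHS in _ = RHS](congr1 (fun A : 'M__ => A i k) (Da _)) summxE.
  apply: eq_bigr => g _; rewrite [RHS]mxE -horner_coef0 horner_comp !hornerE.
  by rewrite (Df g).1.
have T1 i k : (T i k)`_1 = (M i k)`_1.
  transitivity (map_mx (fun q : {poly algC} => q`_1) M i k);
    last by rewrite mxE.
  rewrite coefT [RHS in _ = RHS](congr1 (fun A : 'M__ => A i k) (Da _)) summxE.
  apply: eq_bigr => g _; rewrite [RHS]mxE -[(_ \Po _)`_1]mulr1n -coef_deriv.
  rewrite -horner_coef0 deriv_comp derivD derivX derivC addr0 mulr1
    horner_comp !hornerE.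
  by rewrite (Df g).2.
pose N := \matrix_(i, k) drop_poly 2 (T i k - M i k).
have DT : T = M + 'X^2 *: N.
  apply/matrixP=> i k; rewrite !mxE mulrC.
  have := poly_take_drop 2 (T i k - M i k).
  rewrite (_ : take_poly 2 _ = 0) ?add0r => [-> |];
    first by rewrite addrC subrK.
  apply/polyP=> -[|[|l]]; rewrite coef_take_poly coefB coef0 //=.
    by rewrite T0 subrr.
  by rewrite T1 subrr.
have [h Dh] := det_congruent (char_poly_mx M) (- map_mx polyC N) ('X^2)%:P.
exists h; rewrite -DM -Dh; congr (\det _).
by rewrite DT /char_poly_mx map_mxD map_mxZ opprD addrA scalerN.
Qed.

Lemma map_char_poly_mx_horner (R : comNzRingType) n (A : 'M[R]_n) z :
  map_mx (horner_eval z) (char_poly_mx A) = z%:M - A.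
Proof. by apply/matrixP=> i j; rewrite !mxE /= horner_evalE !hornerE hornerMn
  hornerX. Qed.

Lemma horner_char_poly (R : comNzRingType) n (A : 'M[R]_n) z :
  (char_poly A).[z] = \det (z%:M - A).
Proof. by rewrite -horner_evalE -det_map_mx map_char_poly_mx_horner. Qed.

(** Guarantees a nonzero adjugate at a simple root. *)
Lemma mxtrace_adj_root (R : comNzRingType) n (A : 'M[R]_n) z :
  \tr (\adj (z%:M - A)) = (char_poly A)^`().[z].
Proof.
rewrite -mxtrace_adj_char_poly_mx -horner_evalE -trace_map_mx map_mx_adj.
by rewrite map_char_poly_mx_horner.
Qed.

Lemma adj_root_sum (R : idomainType) n (A : 'M[R]_n.+1) z :
  \adj (z%:M - A) = \sum_(j < n.+2) \sum_(i < j)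
    (char_poly A)`_j *: (z ^+ (j.-1 - i) *: A ^+ i).
Proof.
rewrite -map_char_poly_mx_horner -map_mx_adj adj_char_poly_mx map_mx_sum.
apply: eq_bigr => j _; rewrite map_mx_sum; apply: eq_bigr => i _.
rewrite !map_mxZ /= !horner_evalE hornerC hornerXn; congr (_ *: (_ *: _)).
by apply/matrixP=> k l; rewrite !mxE /= horner_evalE hornerC.
Qed.

Lemma nat_unit_poly (K : fieldType) (sigma : {rmorphism K -> algC}) k :
  k.+1%:R \is a @GRing.unit {poly K}.
Proof.
rewrite -(rmorph_nat polyC) rmorph_unit // unitfE.
by rewrite -(fmorph_eq0 sigma) rmorph_nat pnatr_eq0.
Qed.

(* Equations over [C[u]] in [z] of degree less than [P] are trivial, so a
   square root of [e] lying in the field generated by [u] and [z] over K is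
   a quotient of two elements of K. *)
Lemma square_descent (K : fieldType) (E : fieldType) (sigma : {rmorphism K ->
  algC})
    theta (p : {poly {poly K}}) (tau : {rmorphism {poly algC} -> E}) (z : E)
    (phi := comp_poly ('X + theta%:P) \o map_poly sigma : {rmorphism {poly K}
      -> {poly algC}})
    (psi := horner_eval z \o map_poly (tau \o phi) : {rmorphism {poly {poly
      K}} -> E})
    (e : K) a b :
    p \is monic -> psi p = 0 ->
    (forall h : {poly {poly algC}}, (size h < size p)%N ->
      (map_poly tau h).[z] = 0 -> h = 0) ->
    psi b != 0 -> (psi a / psi b) ^+ 2 = tau (sigma e)%:P ->
  exists s, e = s ^+ 2.
Proof.
move=> monp psip minz nz_b Dab.
(* A square root of e exists in [algC]; with the right sign it is the quotient psi a / psi b. *)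
have [eps Deps Dab'] : exists2 eps, sigma e = eps ^+ 2 & psi a = tau eps%:P *
  psi b.
  have : (psi a / psi b) ^+ 2 == (tau (sqrtC (sigma e))%:P) ^+ 2.
    by rewrite Dab -!rmorphXn /= sqrtCK.
  rewrite eqf_sqr => /orP[] /eqP/(canRL (mulfVK nz_b)) Da.
    by exists (sqrtC (sigma e)); rewrite ?sqrtCK.
  by exists (- sqrtC (sigma e)); rewrite ?sqrrN ?sqrtCK // !rmorphN.
(* Reduction modulo [p] keeps the values at z and brings the degrees into the range of [minz]. *)
pose a0 := Pdiv.Ring.rmodp a p; pose b0 := Pdiv.Ring.rmodp b p.
have psi_mod q : psi (Pdiv.Ring.rmodp q p) = psi q.
  by rewrite [in RHS](Pdiv.RingMonic.rdivp_eq monp q) rmorphD rmorphM psip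
    mulr0 add0r.
have sz_mod q : (size (Pdiv.Ring.rmodp q p) < size p)%N.
  by rewrite Pdiv.Ring.ltn_rmodpN0 // monic_neq0.
have psiE q : psi q = (map_poly tau (map_poly phi q)).[z].
  by rewrite -map_poly_comp.
pose h := map_poly phi a0 - eps%:P *: map_poly phi b0.
have h0 : h = 0.
  apply: minz.
    rewrite (leq_ltn_trans (size_polyD _ _)) // gtn_max size_polyN.
    rewrite (leq_ltn_trans (size_poly _ _)) ?sz_mod //=.
    by rewrite (leq_ltn_trans (size_scale_leq _ _)) // (leq_ltn_trans
      (size_poly _ _)) ?sz_mod.
  rewrite rmorphB /= map_polyZ hornerD hornerN hornerZ -!psiE !psi_mod Dab'.
  by rewrite subrr.
have nz_b0 : b0 != 0.
  by apply: contraNneq nz_b => b00; rewrite -psi_mod -/b0 b00 rmorph0.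
(* Now a0 = eps b0 coefficientwise, so eps is read off from a leading coefficient in x and then one
   in t, both over K. *)
pose bi := lead_coef b0; pose ai := a0`_(size b0).-1.
have nz_bi : bi != 0 by rewrite lead_coef_eq0.
have Dphi : map_poly sigma ai = eps *: map_poly sigma bi.
  have /polyP/(_ (size b0).-1) := h0.
  rewrite coef0 coefB coefZ !coef_map -/ai -lead_coefE -/bi => /eqP.
  (* Substituting u = t - theta undoes the shift in [phi]. *)
  rewrite subr_eq0 => /eqP/(congr1 (comp_poly ('X - theta%:P))).
  rewrite /phi /= comp_polyM comp_polyC -!comp_polyA !comp_polyD !comp_polyX
    !comp_polyC.
  by rewrite subrK !comp_polyXr mul_polyC.
have Dlc : sigma ai`_(size bi).-1 = eps * sigma (lead_coef bi).
  have := congr1 (fun q : {poly algC} => q`_(size bi).-1) Dphi.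
  by rewrite coefZ !coef_map.
exists (ai`_(size bi).-1 / lead_coef bi); apply: (fmorph_inj sigma).
rewrite rmorphXn fmorph_div Dlc mulfK ?fmorph_eq0 ?lead_coef_eq0 //.
Qed.

(** The field of quotients of K[t][z] inside [E] contains all traces needed to descend rho, and with
    it the form. A square root in it of an element of K is compared with one in [algC]. *)
Lemma splitting_field_exists (gT : finGroupType) (G : {group gT}) n
    (rho : mx_representation algC G n.+1) (B : 'M[algC]_n.+1)
    (K : fieldExtType rat) (sigma : {rmorphism K -> algC}) (chi : gT -> K) :
    mx_absolutely_irreducible rho -> invariant_form rho B -> B != 0 ->
    {in G, forall g, \tr (rho g) = sigma (chi g)} ->
  exists (L : fieldType) (iota : {rmorphism K ->
    L}) (rL : mx_representation L G n.+1),
    [/\ {in G, forall g, \tr (rL g) = iota (chi g)},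
        exists2 B' : 'M[L]_n.+1, invariant_form rL B' & B' != 0
      & forall e y, y ^+ 2 = iota e -> exists s, e = s ^+ 2].
Proof.
move=> irr invB nzB Dchi.
have [theta [f [H DH]]] := eisenstein_combination sigma irr.
(* The substitution t = u + theta, from K[t] to polynomials in u over [algC]. *)
pose phi : {rmorphism {poly K} ->
  {poly algC}} := comp_poly ('X + theta%:P) \o map_poly sigma.
pose T := \sum_(g in G) phi (f g) *: map_repr polyC rho g.
have {}DH : char_poly T = 'X^(n.+1) - 'X%:P + ('X^2)%:P * H by rewrite -DH.
have [p [monp szp] Dp] :=
  char_poly_group_comb G n f (fun g => (chi g)%:P) (nat_unit_poly sigma).
have DT : char_poly T = map_poly phi p.
  apply: (Dp _ phi) => g Gg; rewrite map_reprE trace_map_mx Dchi //.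
  by rewrite /phi /= map_polyC comp_polyC.
have [E [tau [z [rz minz]]]] :=
  eisenstein_root_field (char_poly_monic T) (size_char_poly T) DH.
rewrite size_char_poly -szp in minz.
pose kap : {rmorphism algC -> E} := tau \o polyC.
pose rE := map_repr kap rho.
pose tphi : {rmorphism {poly K} -> E} := tau \o phi.
pose psi : {rmorphism {poly {poly K}} -> E} := horner_eval z \o map_poly tphi.
have psiC q : psi q%:P = tphi q by rewrite /psi /= map_polyC horner_evalE
  hornerC.
have psiX : psi 'X = z by rewrite /psi /= map_polyX horner_evalE hornerX.
have psiCC x : psi x%:P%:P = kap (sigma x).
  by rewrite psiC /tphi /phi /= map_polyC comp_polyC.
pose TE := map_mx tau T.
have DTE : TE = \sum_(g in G) tphi (f g) *: rE g.
  rewrite /TE map_mx_sum; apply: eq_bigr => g _; rewrite map_mxZ;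
    congr (_ *: _).
  by apply/matrixP=> i k; rewrite !mxE.
have cpTE : char_poly TE = map_poly tau (char_poly T) by rewrite map_char_poly.
have det0 : \det (z%:M - TE) = 0 by rewrite -horner_char_poly cpTE.
(* The trace of the adjugate is the derivative of the characteristic polynomial at z: it has lower
   degree and is a nonzero polynomial in characteristic 0, so z is not a root of it. *)
have nz_adj : \adj (z%:M - TE) != 0.
  apply/eqP=> adj0; have := mxtrace_adj_root TE z.
  rewrite adj0 mxtrace0 cpTE deriv_map => /esym/minz.
  rewrite szp -(size_char_poly T) lt_size_deriv ?monic_neq0 ?char_poly_monic //.
  move/(_ isT)/polyP/(_ n); rewrite coef_deriv coef0.
  have := char_poly_monic T; rewrite monicE lead_coefE size_char_poly /= =>
    /eqP->.
  by move/eqP; rewrite -(rmorph_nat polyC) polyC_eq0 pnatr_eq0.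
have [u [v Duv]] := adj_rank1 det0 nz_adj.
have [b Db] := choice (group_comb_exp G f).
(* u v is the adjugate of z - T, a polynomial in z and T over K[t]; its traces against rho(g)
   therefore only involve z, t and values of chi. *)
have inpsi g : g \in G -> exists d, \tr (u *m v *m rE g) = psi d.
  move=> Gg; exists (\sum_(j < n.+2) \sum_(i < j) (p`_j)%:P * ('X ^+ (j.-1 -
    i) *
    \sum_(k in G) (b i k)%:P * (chi (k * g)%g)%:P%:P)).
  rewrite -Duv adj_root_sum mulmx_suml linear_sum rmorph_sum;
    apply: eq_bigr => j _.
  rewrite mulmx_suml linear_sum rmorph_sum; apply: eq_bigr => i _.
  rewrite -[LHS]/(\tr _) -!scalemxAl !mxtraceZ [RHS]rmorphM [X in _ = _ *
    X]rmorphM rmorphXn psiX psiC.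
  rewrite cpTE DT -map_poly_comp coef_map; congr (_ * (_ * _)).
  rewrite DTE Db mulmx_suml linear_sum rmorph_sum; apply: eq_bigr => k Gk.
  rewrite -[LHS]/(\tr _) -scalemxAl mxtraceZ [RHS]rmorphM psiC psiCC -Dchi
    ?groupM //.
  by rewrite -repr_mxM // map_reprE trace_map_mx.
have [L [j [psiL [jpsi Lfrac]]]] := image_fraction_field psi.
pose iota : {rmorphism K -> L} := psiL \o (polyC \o polyC).
have kapsig x : kap (sigma x) = j (iota x) by rewrite jpsi psiCC.
have irrE : mx_absolutely_irreducible rE by rewrite map_mx_abs_irr.
have [||rL [P uP DrL]] := repr_descent (j := j) (u := u) (v := v) irrE.
- by rewrite -Duv.
- by move=> g /inpsi[d Dd]; exists (psiL d); rewrite jpsi.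
exists L, iota, rL; split=> [g Gg||e y Dy].
- apply: (fmorph_inj j); rewrite -trace_map_mx DrL // mxtrace_mulC mulKmx //.
  by rewrite map_reprE trace_map_mx Dchi.
- apply: (invariant_form_descent (B := map_mx kap B) _ _ DrL uP).
  + by rewrite -(rmorph_nat kap) fmorph_eq0 pnatr_eq0 -lt0n cardG_gt0.
  + by rewrite -(rmorph_nat kap) fmorph_eq0 pnatr_eq0.
  + split; first by rewrite map_trmx (proj1 invB).
    by move=> g Gg; rewrite map_trmx -!map_mxM (proj2 invB).
  + by rewrite map_mx_eq0.
have [c [d [nz_d Dcd]]] := Lfrac y.
apply: (@square_descent K E sigma theta p tau z e c d) => //.
  by rewrite -[RHS]rz DT -map_poly_comp.
by rewrite -[X in X ^+ 2]Dcd -rmorphXn Dy -kapsig.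
Qed.

(** * Existence and uniqueness of the orthogonal determinant *)

Theorem theorem3p3 (gT : finGroupType) (G : {group gT}) (chi : 'CF(G))
    (n : nat) (K : fieldExtType rat) (sigma : {rmorphism K -> algC}) :
  chi \in irr G ->
  orthogonal_char chi ->
  chi 1%g = n%:R ->
  ~~ odd n ->
  is_character_field chi sigma ->
  exists d : K,
    [/\ d != 0, totally_positive d, is_orthogonal_det chi n sigma d
      & forall d' : K, d' != 0 -> totally_positive d' ->
          is_orthogonal_det chi n sigma d' -> in_square_class d d'].
Proof.
move=> irr_chi [m [rho Drho [B invB nzdetB]]] chi1 even_n [s Ds _].
have Dm : m = n by apply/eqP; rewrite -(eqr_nat algC) -chi1 -Drho cfRepr1.
rewrite {m}Dm in rho Drho B invB nzdetB.
case: n => [|n] in rho Drho B invB nzdetB chi1 even_n *.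
  by have /irrP[i Di] := irr_chi; have := irr1_neq0 i; rewrite -Di chi1 eqxx.
have irr : mx_absolutely_irreducible rho.
  have /irr_reprP[[k r] irr_r Dr] := irr_chi.
  apply/groupC/(mx_rsim_irr _ irr_r)/cfRepr_rsimP.
  by rewrite -Dr Drho.
have nzB : B != 0 by apply: contraNneq nzdetB => ->; rewrite det0.
(* Values of chi are lifted to K, with default 0 outside G. *)
have [x Dx] : exists x : gT -> K, {in G, forall g, sigma (x g) = chi g}.
  have : forall g, exists y, g \in G -> sigma y = chi g.
    move=> g; have [Gg|] := boolP (g \in G); last by exists 0.
    have /mapP[y _ Dy] : chi g \in [seq sigma x | x <- s] by rewrite Ds image_f.
    by exists y.
  by case/choice=> y Dy; exists y.
have Dtr : {in G, forall g, \tr (rho g) = sigma (x g)}.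
  by move=> g Gg; rewrite Dx // -Drho cfunE Gg.
have trL (L : fieldType) (iota : {rmorphism K ->
  L}) (rL : mx_representation L G n.+1) :
    has_character chi sigma iota rL <-> {in G, forall g, \tr (rL g) = iota (x
      g)}.
  split=> DL g Gg; last by exists (x g); rewrite ?Dx // DL.
  have [y Dy ->] := DL g Gg; congr (iota _); apply: (fmorph_inj sigma).
  by rewrite Dy Dx.
have [h odd_h nz_h] := odd_comb_det_neq0 irr invB nzB even_n.
have natU k : k.+1%:R \is a @GRing.unit K 
  by rewrite unitfE -(fmorph_eq0 sigma) rmorph_nat pnatr_eq0.
have [p [monp szp] Dp] := char_poly_group_comb G n (fun g => (h g)%:~R) x natU.
(* The constant coefficient is the determinant up to the sign (-1)^(n+1), which is 1 as the degree
   n+1 is even. *)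
have det_p (L : fieldType) (iota : {rmorphism K ->
  L}) (rL : mx_representation L G n.+1) :
    {in G, forall g, \tr (rL g) = iota (x g)} ->
  \det (\sum_(g in G) (h g)%:~R *: rL g) = iota p`_0.
  move=> DL; rewrite -coef_map -(Dp _ iota rL) // char_poly_det -signr_odd
    (negPf even_n) mul1r.
  by congr (\det _); apply: eq_bigr => g _; rewrite rmorph_int.
have nz_p : p`_0 != 0 by rewrite -(fmorph_eq0 sigma) -(det_p _ sigma rho).
have nz2 (L : fieldType) (iota : {rmorphism K -> L}) : 2%:R != 0 :> L.
  by rewrite -(rmorph_nat iota) fmorph_eq0 -(fmorph_eq0 sigma) rmorph_nat
    pnatr_eq0.
have det_d : is_orthogonal_det chi n.+1 sigma p`_0.
  move=> L iota rL /trL DL BL invBL nzBL.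
  have irrL := abs_irr_same_character Dtr DL irr.
  have nzdetL := invariant_form_nondegenerate (mx_abs_irrW irrL) invBL nzBL.
  have [|c Dc] := det_odd_comb_square (h := fun g =>
    (h g)%:~R) (nz2 L iota) invBL.
    by move=> g Gg; rewrite /= odd_h // rmorphN.
  rewrite (det_p _ iota) // in Dc.
  have nz_d : iota p`_0 != 0 by rewrite fmorph_eq0.
  have nz_c : c != 0 by have := mulf_neq0 nz_d nzdetL; rewrite Dc expf_eq0.
  (* From d det B = c^2 it follows that det B = d (c/d)^2. *)
  exists (c / iota p`_0); first by rewrite mulf_neq0 ?invr_eq0.
  apply: (mulfI nz_d); rewrite Dc expr_div_n mulrA -expr2 mulrC.
  by rewrite divfK ?expf_neq0.
exists p`_0; split=> // [R tau|d' nz_d' _ det_d'].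
  apply: (@odd_comb_char_poly_gt0 gT G K sigma n.+1 rho h p R tau odd_h monp
    nz_p).
  rewrite -(Dp _ sigma rho Dtr); congr (char_poly _).
  by apply: eq_bigr => g _; rewrite rmorph_int.
have [L [iota [rL [DL [B' invB' nzB'] sqL]]]] := splitting_field_exists irr
  invB nzB Dtr.
have [c nz_c Dc] := det_d L iota rL (proj2 (trL _ _ _) DL) B' invB' nzB'.
have [c' nz_c' Dc'] := det_d' L iota rL (proj2 (trL _ _ _) DL) B' invB' nzB'.
(* In L, d c^2 = det B' = d' c'^2, so d'/d is the square of c/c' there and hence a square in K. *)
have [r Dr] : exists r, d' / p`_0 = r ^+ 2.
  apply: (sqL _ (c / c')); rewrite fmorph_div expr_div_n.
  have nz_d : iota p`_0 != 0 by rewrite fmorph_eq0.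
  apply/eqP; rewrite eqr_div ?expf_neq0 //.
  by rewrite -Dc' mulrC -Dc.
have : r ^+ 2 != 0 by rewrite -Dr mulf_neq0 ?invr_eq0.
by rewrite expf_eq0 /= => nz_r; exists r; rewrite // -Dr mulrC divfK.
Qed.
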